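(* Consider the Markov-modulated single-server queue described in the context. For any service requirement distributions $H_d(\cdot)$ and any service discipline that does not depend on the state of the environment, the mean of the workload satisfies $$\mathbb{E}W=\frac{\sum_{d=1}^D\left[\pi_d\lambda_d h_{d2}/2+a_d\pi_d(\lambda_d h_{d1}-c_d)+p_{0,d}c_d a_d\right]}{c_\infty(1-\rho_\infty)},$$ where $p_{0,d}=\mathbb{P}(W=0,Z=d)$ and $\boldsymbol{a}=(a_1,\ldots,a_D)^T$ is a solution of $$[Q\boldsymbol{a}]_d = c_d-\lambda_d h_{d1}-c_\infty(1-\rho_\infty),\qquad d=1,\ldots,D.$$ Furthermore, $1-\rho_\infty=\sum_{d=1}^D p_{0,d}c_d/c_\infty$.
   Context: A single-server queue is modulated by an independent external environment $Z$, an irreducible continuous-time Markov chain on the finite state space $\{1,\ldots,D\}$ with generator $Q=(q_{d\ell})_{d,\ell=1}^D$ and invariant distribution $\boldsymbol{\pi}=(\pi_1,\ldots,\pi_D)$. While the environment is in state $d$, customers arrive according to a Poisson process with rate $\lambda_d$. A customer arriving while the environment is in state $d$ has a service requirement with distribution function $H_d(\cdot)$, whose first and second moments are $h_{d1}$ and $h_{d2}$; the requirement does not change further with the environment. The service capacity is scaled by a factor $c_d$ while the environment is in state $d$, so it can change during the service of a customer. Set $c_\infty:=\sum_d\pi_d c_d$ (the service capacity averaged over the environment) and $\rho_\infty:=\sum_d\pi_d\lambda_d h_{d1}/c_\infty$ (the traffic intensity). The workload $W$ is defined as the time it takes to empty the system at an arbitrary moment in time given the observed environment; $(W,Z)$ is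 considered in steady state.
   Formalization: The workload is taken as the total remaining service requirement (time to empty at unit capacity), not the literal emptying time, and service disciplines are assumed work-conserving (no capacity wasted while work is present); the formula fails otherwise. *)

(* Defs.v *)
From HB Require Import structures.
From mathcomp Require Import all_boot all_order all_algebra.
From mathcomp Require Import all_classical all_reals all_analysis.

Set Implicit Arguments.
Unset Strict Implicit.
Unset Printing Implicit Defensive.

Import Order.TTheory GRing.Theory Num.Theory.
Import numFieldNormedType.Exports.

Local Open Scope classical_set_scope.
Local Open Scope ring_scope.

(** * Generators of continuous-time Markov chains on ['I_D] *)

Definition is_generator (R : realType) (D : nat) (Q : 'M[R]_D) : Prop :=
  (forall i j, i != j -> 0 <= Q i j) /\ (forall i, \sum_j Q i j = 0).

Definition irreducible (R : realType) (D : nat) (Q : 'M[R]_D) : Prop :=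
  forall i j, connect [rel k l | 0 < Q k l] i j.

Definition invariant_distribution (R : realType) (D : nat)
    (Q : 'M[R]_D) (pi : 'rV[R]_D) : Prop :=
  [/\ forall i, 0 <= pi 0 i, \sum_i pi 0 i = 1 & pi *m Q = 0].

(** Entries [p t i j] are the probabilities to be in [j] a time [t] after being
    in [i]; [Q] is the right derivative of [p] at [0]. *)
Record transition_semigroup (R : realType) (D : nat) (Q : 'M[R]_D)
    (p : R -> 'M[R]_D) : Prop := {
  semigroup_ge0 : forall (t : R) i j, 0 <= t -> 0 <= p t i j ;
  semigroup_sum1 : forall (t : R) i, 0 <= t -> \sum_j p t i j = 1 ;
  semigroup0 : p 0 = 1%:M ;
  semigroupD : forall s t : R, 0 <= s -> 0 <= t -> p (s + t) = p s *m p t ;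
  semigroup_generator : forall i j,
    (p t i j - (1%:M : 'M[R]_D) i j) / t @[t --> 0^'+] --> Q i j }.

(** * Mutual independence of classes of events *)

Definition mutually_independent d (T : measurableType d) (R : realType)
    (P : probability T R) (I : eqType) (F : I -> set (set T)) : Prop :=
  forall (s : seq I) (E : I -> set T), uniq s ->
    (forall i, i \in s -> F i (E i)) ->
    P (\bigcap_(i in [set` s]) E i) = (\prod_(i <- s) P (E i))%E.

(** * The environment *)

Section Environment.
Context d (T : measurableType d) (dS : measure_display) (S : measurableType dS).
Variables (R : realType) (D : nat).

(** Events determined by the initial data [X0] and by [Z] at times in [J]. *)
Definition environment_events (X0 : T -> S) (Z : R -> T -> 'I_D) (J : set R) :
    set (set T) :=
  <<s [set E | (exists2 A, measurable A & E = X0 @^-1` A) \/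
               (exists u i, J u /\ E = Z u @^-1` [set i])] >>.

(** [X0] describes the queue at time [0]. It may depend on [Z 0], but given
    [Z 0] it carries no information on the future of [Z]: the Markov property
    holds relative to [X0] together with the past of [Z]. *)
Record markov_environment (P : probability T R) (Q : 'M[R]_D)
    (X0 : T -> S) (Z : R -> T -> 'I_D) : Prop := {
  environment_measurable : forall (t : R) i, 0 <= t -> measurable (Z t @^-1` [set i]) ;
  environment_right_continuous : forall w (t : R), 0 <= t ->
    \forall s \near t^'+, Z s w = Z t w ;
  environment_left_limit : forall w (t : R), 0 < t ->
    exists i, \forall s \near t^'-, Z s w = i ;
  environment_markov : exists2 p, transition_semigroup Q p &
    forall (s t : R) E i j, 0 <= s -> 0 <= t ->
      environment_events X0 Z `[0, s] E ->
      P (E `&` [set w | Z s w = i] `&` [set w | Z (s + t) w = j]) =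
      (P (E `&` [set w | Z s w = i]) * (p t i j)%:E)%E }.

End Environment.

(** * Customers and service disciplines *)

(** [(None, n)] is the [n]-th customer present at time [0]; [(Some i, n)] is the
    customer attached to the [n]-th point of a Poisson stream with rate
    [lambda i], who enters only if the environment is then in state [i]. *)
Definition customer (D : nat) : Type := (option 'I_D * nat)%type.

Definition total_over_customers (R : realType) (D : nat) (f : customer D -> R) :
    \bar R :=
  (\sum_(j : option 'I_D) \sum_(0 <= n <oo) (f (j, n))%:E)%E.

(** [phi x r t k] is the fraction of the available capacity that customer [k]
    receives at time [t] when the remaining requirement of customer [k'] at time
    [u] is [r u k']. The environment is not an argument. The parameter [x : S]
    covers what has to be known about time [0] (such as the customer then in
    service) and the randomness used by a randomized discipline. *)
Definition discipline (R : realType) (D : nat) (S : Type) : Type :=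
  S -> (R -> customer D -> R) -> R -> customer D -> R.

Record service_discipline (R : realType) (D : nat) (S : Type)
    (phi : discipline R D S) : Prop := {
  discipline_nonanticipating : forall x r r' t, 0 <= t ->
    (forall u, 0 <= u <= t -> r u = r' u) -> phi x r t = phi x r' t ;
  discipline_ge0 : forall x r t k, 0 <= t -> 0 <= phi x r t k ;
  discipline_absent : forall x r t k, 0 <= t -> r t k <= 0 -> phi x r t k = 0 ;
  discipline_work_conserving : forall x r t, 0 <= t ->
    finite_set [set k | 0 < r t k] -> (exists k, 0 < r t k) ->
    total_over_customers (phi x r t) = 1%E }.

(** * The modulated queue *)

Section Queue.
Context d (T : measurableType d) (dS : measure_display) (S : measurableType dS).
Variables (R : realType) (D : nat) (P : probability T R).
(** [lambda], [c], [H]: arrival rates, capacities and requirement laws.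
    [V i n], [B i n]: interarrival times and requirements in stream [i].
    [b n x]: remaining requirement at time [0] of [(None, n)], with [b n x = 0]
    when there is no such customer. *)
Variables (lambda c : 'I_D -> R) (H : 'I_D -> probability (measurableTypeR R) R).
Variables (X0 : {mfun T >-> S}) (Z : R -> T -> 'I_D).
Variables (V B : 'I_D -> nat -> {RV P >-> R}) (b : nat -> {mfun S >-> R}).

Definition driving_events (a : option (bool * 'I_D * nat)) : set (set T) :=
  match a with
  | None => environment_events X0 Z `[0, +oo[
  | Some (true, i, n) => [set E | exists2 A, measurable A & E = V i n @^-1` A]
  | Some (false, i, n) => [set E | exists2 A, measurable A & E = B i n @^-1` A]
  end.

Record modulated_input : Prop := {
  interarrival_law : forall i n A, 0 < lambda i -> measurable A ->
    P (V i n @^-1` A) = exponential_prob (lambda i) A ;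
  requirement_law : forall i n A, measurable A -> P (B i n @^-1` A) = H i A ;
  input_independent : mutually_independent P driving_events }.

Definition arrival_epoch (i : 'I_D) (n : nat) (w : T) : R :=
  \sum_(m < n.+1) V i m w.

(** A stream with rate [0] has no points. *)
Definition arrived_by (i : 'I_D) (n : nat) (t : R) (w : T) : bool :=
  [&& 0 < lambda i, arrival_epoch i n w <= t & Z (arrival_epoch i n w) w == i].

Definition work_brought (k : customer D) (t : R) (w : T) : R :=
  match k with
  | (None, n) => b n (X0 w)
  | (Some i, n) => if arrived_by i n t w then B i n w else 0
  end.

Variable phi : discipline R D S.
Variable r : R -> T -> customer D -> R.

Definition service_rate (k : customer D) (t : R) (w : T) : R :=
  c (Z t w) * phi (X0 w) (r ^~ w) t k.

(** [r t w k] is the remaining requirement of customer [k] at time [t]. *)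
Record queue_dynamics : Prop := {
  residual_ge0 : forall (t : R) w k, 0 <= t -> 0 <= r t w k ;
  residual_finite : forall (t : R) w, 0 <= t -> finite_set [set k | 0 < r t w k] ;
  service_measurable : forall w k,
    measurable_fun (`[0, +oo[ : set R) (fun t : R => service_rate k t w) ;
  residualE : forall (t : R) w k, 0 <= t ->
    r t w k = work_brought k t w
              - \int[lebesgue_measure]_(s in `[0, t]) service_rate k s w }.

(** The workload is measured in time units of a server of capacity [1]. *)
Definition is_workload (W : R -> {RV P >-> R}) : Prop :=
  forall (t : R) w, 0 <= t -> (W t w)%:E = total_over_customers (r t w).

Definition steady_state (W : R -> {RV P >-> R}) : Prop :=
  forall (t : R) i A, 0 <= t -> measurable A ->
    P [set w | A (W t w) /\ Z t w = i] = P [set w | A (W 0 w) /\ Z 0 w = i].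

End Queue.

(** * Long-run parameters *)

Definition mean_capacity (R : realType) (D : nat) (pi : 'rV[R]_D)
    (c : 'I_D -> R) : R :=
  \sum_i pi 0 i * c i.

Definition traffic_intensity (R : realType) (D : nat) (pi : 'rV[R]_D)
    (lambda h1 c : 'I_D -> R) : R :=
  (\sum_i pi 0 i * lambda i * h1 i) / mean_capacity pi c.

(* Main.v *)
Require Import Defs.
From HB Require Import structures.
From mathcomp Require Import all_boot all_order all_algebra.
From mathcomp Require Import ring lra.
From mathcomp Require Import all_classical all_reals all_analysis.
From mathcomp Require Import measurable_realfun.

Set Implicit Arguments.
Unset Strict Implicit.
Unset Printing Implicit Defensive.

Import Order.TTheory GRing.Theory Num.Theory.
Import numFieldNormedType.Exports.

Local Open Scope classical_set_scope.
Local Open Scope ring_scope.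

(** Let [psi_j = E(exp(- theta W); Z = j)] and let [beta_j] be the Laplace
    transform of [H_j]. Comparing times [0] and [h] in steady state and letting
    [h -> 0] gives, for every [theta > 0],
      [sum_i psi_i q_ij = lambda_j (1 - beta_j) psi_j - theta c_j (psi_j - p0_j)].
    Up to [o(h)] the workload decreases at rate [c_j] while it is positive, and
    at most one customer arrives, whose requirement is independent of the state at
    time [0]; the discipline plays no role because it is work conserving.

    As [theta -> 0] the equation shows that the law of [Z] is invariant, hence
    equals [pi]; its sum over [j], divided by [theta], gives
    [m := c_inf (1 - rho) = sum_j c_j p0_j]. Weighting the equations by
    [1 - theta a_j] cancels the terms of first order by the choice of [a], and
    leaves [m E((1 - exp(- theta W)) / theta) -> K], where [K] is the numerator of
    the claimed formula. If [m > 0], Fatou's lemma turns this into [m E(W) = K]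
    without assuming that [W] is integrable. The case [m = 0] cannot occur: then
    [K = 0], while [K] is the sum of [sum_j pi_j lambda_j h2_j / 2] and half the
    Dirichlet form of [a], so no work would ever arrive and [m = c_inf > 0]. *)

(** * Generators and the exponential function *)

(** Origin of the weights [1 - theta a_j]: in matrix form the equations read psi M(theta) = theta
    (c_j p0_j)_j, where M(theta) = Q + theta diag(c) - diag(lambda (1 - beta(theta))). As Q maps the
    constant vector 1 to 0, the choice of [a] gives M(theta) (1 - theta a) = theta m 1 + O(theta^2).
    The weight is thus the first-order perturbation of the eigenvector 1 of [Q], and theta m that of
    its eigenvalue 0. Why the small step is tractable: a customer of stream [i] enters only in state
    [i], so while the environment is constant only the stream of [Z 0] counts, and its first two
    interarrival times decide whether there are no, one or more arrivals. The change of environment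
    is split off with the workload frozen at time 0, where the Markov property evaluates it exactly;
    what a jump without arrival leaves over is a change of workload of order h. Hence the
    probability of a jump before h only has to tend to 0, without a rate. A jump together with an
    arrival gains its factor h from independence. *)

Lemma harmonic_function_constant (R : realType) (D : nat) (Q : 'M[R]_D)
    (x : 'cV[R]_D) : is_generator Q -> irreducible Q -> Q *m x = 0 ->
  forall i j, x i 0 = x j 0.
Proof.
(* Maximum principle: at a maximizing state [m] the sum over [j] of [Q m j * (x m 0 - x j 0)]
   vanishes and has nonnegative terms, so every state reached by one transition is maximizing too;
   irreducibility carries this to all states. *)
move=> [Q0 Qs] Qirr Qx i0.
have [m _ mmax] : exists2 m, true & forall j, x j 0 <= x m 0.
  by case: (@Order.TotalTheory.arg_maxP _ _ _ i0 xpredT (fun j => x j 0) isT)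
    => m _ h; exists m => // j; exact: h.
suff mE j : x j 0 = x m 0 by move=> j; rewrite (mE i0) (mE j).
have step k l : x k 0 = x m 0 -> 0 < Q k l -> x l 0 = x m 0.
  move=> xk Qkl; have [->//|nkl] := eqVneq l k.
  have : \sum_j Q k j * (x k 0 - x j 0) = 0.
    under eq_bigr do rewrite mulrBr.
    rewrite sumrB -mulr_suml Qs mul0r sub0r.
    by move/matrixP: Qx => /(_ k 0); rewrite !mxE => ->; rewrite oppr0.
  have ge0 j' : true -> 0 <= Q k j' * (x k 0 - x j' 0).
    move=> _; have [->|nj] := eqVneq k j'; first by rewrite subrr mulr0.
    by rewrite mulr_ge0 ?Q0// subr_ge0 xk.
  move/eqP; rewrite psumr_eq0// => /allP/(_ l (mem_index_enum _))/=.
  by rewrite mulf_eq0 gt_eqF//= subr_eq0 xk => /eqP.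
have /connectP[p pth ->] := Qirr m j.
elim: p m {mmax} (erefl (x m 0)) pth step => //= a p IH k _ /andP[Qka pth] step.
have xa : x a 0 = x k 0 by exact: (step k a).
rewrite -xa; apply: IH => // u v; rewrite xa; exact: step.
Qed.

(** The right kernel of [Q] consists of constant vectors, and a square matrix has left and right
    kernels of equal dimension. The left kernel is therefore the line through [pi], and the total
    mass fixes the multiple. *)
Lemma invariant_distribution_unique (R : realType) (D : nat) (Q : 'M[R]_D)
    (mu pi : 'rV[R]_D) : is_generator Q -> irreducible Q ->
  mu *m Q = 0 -> \sum_i mu 0 i = 1 -> invariant_distribution Q pi -> mu = pi.
Proof.
move=> Qgen Qirr muQ mu1 [_ pi1 piQ].
have rkT : (\rank (kermx Q^T) <= 1)%N.
  have i0 : 'I_D.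
    by case: D {Q mu Qgen Qirr muQ mu1 piQ} pi pi1 => [|n] pi;
      [rewrite big_ord0 => /esym/eqP; rewrite oner_eq0|move=> _; exact: ord0].
  apply: leq_trans (rank_leq_row (const_mx 1 : 'rV[R]_D)).
  apply: mxrankS; apply/row_subP => i.
  apply/sub_rVP; exists (row i (kermx Q^T) 0 i0).
  have : row i (kermx Q^T) *m Q^T = 0 by rewrite -row_mul mulmx_ker row0.
  move/(congr1 trmx); rewrite trmx_mul trmxK trmx0.
  move/(harmonic_function_constant Qgen Qirr) => cst.
  by apply/rowP => j; have := cst j i0; rewrite !mxE mulr1.
have rk : (\rank (kermx Q) <= 1)%N by move: rkT; rewrite !mxrank_ker mxrank_tr.
have pi_neq0 : pi != 0.
  apply/eqP => p0; move: pi1; rewrite p0.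
  under eq_bigr do rewrite mxE.
  by rewrite sumr_const mul0rn => /esym/eqP; rewrite oner_eq0.
have /sub_kermxP pik := piQ; have /sub_kermxP muk := muQ.
have : (mu <= pi)%MS.
  apply: submx_trans muk _.
  have /mxrank_leqif_eq[_ rkE] := pik.
  suff : (pi == kermx Q)%MS by case/andP.
  by rewrite -rkE eqn_leq mxrankS//= (leq_trans rk)// lt0n mxrank_eq0.
case/sub_rVP => k muE; move: mu1; rewrite muE.
under eq_bigr do rewrite mxE.
by rewrite -mulr_sumr pi1 mulr1 => ->; rewrite scale1r.
Qed.

(** After expansion of the square, the terms in [a j 0 ^+ 2] cancel by invariance and those in
    [a i 0 ^+ 2] because rows of [Q] sum to 0; reversibility is not involved. *)
Lemma dirichlet_form (R : realType) (D : nat) (Q : 'M[R]_D) (pi : 'rV[R]_D)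
    (a : 'cV[R]_D) : is_generator Q -> pi *m Q = 0 ->
  \sum_i \sum_j pi 0 i * Q i j * (a j 0 - a i 0) ^+ 2
    = - 2 * \sum_i pi 0 i * a i 0 * (Q *m a) i 0.
Proof.
move=> [_ Qs] piQ.
have E1 : \sum_i \sum_j pi 0 i * Q i j * a j 0 ^+ 2 = 0.
  rewrite exchange_big/= big1// => j _; rewrite -mulr_suml.
  by move/matrixP: piQ => /(_ 0 j); rewrite !mxE => ->; rewrite mul0r.
have E2 : \sum_i \sum_j pi 0 i * Q i j * a i 0 ^+ 2 = 0.
  rewrite big1// => i _; rewrite -mulr_suml -mulr_sumr Qs.
  by rewrite mulr0 mul0r.
transitivity (- 2 * (\sum_i pi 0 i * a i 0 * (Q *m a) i 0)
  + \sum_i \sum_j pi 0 i * Q i j * a j 0 ^+ 2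
  + \sum_i \sum_j pi 0 i * Q i j * a i 0 ^+ 2); last by rewrite E1 E2 !addr0.
rewrite mulr_sumr -!big_split/=.
apply: eq_bigr => i _; rewrite mxE !mulr_sumr -!big_split/=.
by apply: eq_bigr => j _; ring.
Qed.

Section exponential_bounds.
Variable R : realType.
Implicit Types x y h : R.

Lemma expR_sub1_le y : expR y - 1 <= y * expR y.
Proof.
have := expR_ge1Dx (- y); rewrite expRN => H.
have : (1 - y) * expR y <= 1 by rewrite -ler_pdivlMr ?expR_gt0// div1r.
by rewrite mulrBl mul1r; lra.
Qed.

Lemma expR_taylor1 y : 0 <= y -> 0 <= expR y - 1 - y <= y ^+ 2 * expR y.
Proof.
move=> y0; have H1 := expR_ge1Dx y; have H2 := expR_sub1_le y.
apply/andP; split; first lra.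
have : y * (expR y - 1) <= y * (y * expR y) by rewrite ler_wpM2l.
by rewrite expr2 -mulrA; lra.
Qed.

Lemma expRN_bounds y : 0 <= y -> 0 <= 1 - expR (- y) <= y.
Proof.
move=> y0; have := expR_ge1Dx (- y).
have : expR (- y) <= 1 by rewrite -expR0 ler_expR oppr_le0.
lra.
Qed.

Lemma expRN_taylor1 y : 0 <= y -> 0 <= expR (- y) - 1 + y <= y ^+ 2.
Proof.
move=> y0; have H1 := expR_ge1Dx (- y); apply/andP; split; first lra.
have H2 := expR_ge1Dx y.
have : expR (- y) * (1 + y) <= 1.
  by rewrite expRN mulrC ler_pdivrMr ?expR_gt0// mul1r.
have : 0 <= expR (- y) by exact: expR_ge0.
nra.
Qed.

(** The mean value theorem bounds the remainder by [y] times its derivative at an intermediate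
    point, which [expRN_taylor1] controls; this costs the factor 1/6 of Taylor's formula. *)
Lemma expRN_taylor2 y : 0 <= y ->
  `|expR (- y) - 1 + y - y ^+ 2 / 2| <= y ^+ 3.
Proof.
rewrite le_eqVlt => /predU1P[<-|y0].
  by rewrite oppr0 expR0 !expr0n/= mul0r !(subrr,addr0) normr0.
pose F (z : R) := expR (- z) - 1 + z - z ^+ 2 / 2.
pose F' (z : R) := - expR (- z) + 1 - z.
have dF z : is_derive z (1:R) F (F' z).
  rewrite /F /F'.
  apply: is_derive_eq.
  by rewrite /= !scaler1 /GRing.scale/= ; field.
have cF : {within `[0, y], continuous F}.
  apply: derivable_within_continuous => z _.
  by case: (dF z).
have [] := @MVT R F F' 0 y y0 (fun z _ => dF z) cF.
move=> z; rewrite in_itv/= => /andP[z0 zy].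
rewrite {1 2}/F oppr0 expR0 !expr0n/= mul0r !(subrr,addr0,subr0) => ->.
rewrite exprSr normrM (gtr0_norm y0) ler_wpM2r ?(ltW y0)//.
have /andP[H1 H2] := expRN_taylor1 (ltW z0).
rewrite /F' ler_norml; apply/andP; split; last nra.
have : z ^+ 2 <= y ^+ 2 by nra.
lra.
Qed.

Lemma expRN_lipschitz x y : 0 <= x -> 0 <= y ->
  `|expR (- x) - expR (- y)| <= `|x - y|.
Proof.
wlog xy : x y / x <= y => [wlg x0 y0|x0 y0].
  case: (leP x y) => [|/ltW] xy; first exact: wlg.
  by rewrite distrC (distrC x) wlg.
have -> : expR (- y) = expR (- x) * expR (- (y - x)).
  by rewrite -expRD; congr expR; ring.
rewrite -{1}[expR (- x)]mulr1 -mulrBr normrM.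
have /andP[H1 H2] := @expRN_bounds (y - x) ltac:(lra).
rewrite (ger0_norm (expR_ge0 _)) (ger0_norm H1) distrC ger0_norm; last lra.
rewrite -[leRHS]mul1r ler_pM ?expR_ge0//.
by rewrite -expR0 ler_expR oppr_le0.
Qed.

End exponential_bounds.

(** * Integrals restricted to events *)

Section restricted_expectation.
Context d (T : measurableType d) (R : realType) (P : probability T R).

(** The pushforward of the restricted measure is the unnormalised law of [X] on [E]; through it,
    identities between probabilities of events become identities between integrals. *)
Lemma integral_pushforward_mrestr d' (U : measurableType d') (X : T -> U)
    (E : set T) (mE : measurable E) (f : U -> \bar R) :
  measurable_fun setT X -> measurable_fun setT f -> (forall y, (0 <= f y)%E) ->
  (\int[pushforward (mrestr P mE) X]_y f y = \int[P]_(x in E) f (X x))%E.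
Proof.
move=> mX mf f0.
rewrite ge0_integral_pushforward// preimage_setT.
have mfX : measurable_fun setT (fun w => f (X w)) by exact: measurableT_comp mf mX.
transitivity (\int[mrestr P mE]_(x in E) (f \o X) x)%E.
  rewrite [RHS]integral_mkcond.
  apply: ge0_ae_eq_integral => //.
  - by apply/(measurable_restrictT _ mE); exact: measurable_funTS.
  - by move=> x _; exact: f0.
  - by move=> x _; rewrite /patch; case: ifP => // _; exact: f0.
  - exists (~` E); split; first exact: measurableC.
      by rewrite /= /mrestr setICl measure0.
    move=> x /= /not_implyP[_ h] Ex; apply: h.
    by rewrite /patch mem_set.
apply: eq_measure_integral => A mA AE.
by rewrite /= /mrestr (setIidl AE).
Qed.

(** Serves stationarity with [k = 1] and the Markov property with [k] a transition probability. *)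
Lemma integral_eq_scale (X X' : {mfun T >-> R}) (E E' : set T) (k : R)
    (f : R -> R) : measurable E -> measurable E' -> 0 <= k ->
  (forall A, measurable A ->
    P (X @^-1` A `&` E) = (k%:E * P (X' @^-1` A `&` E'))%E) ->
  measurable_fun setT f -> (forall y, 0 <= f y) ->
  (\int[P]_(w in E) (f (X w))%:E = k%:E * \int[P]_(w in E') (f (X' w))%:E)%E.
Proof.
move=> mE mE' k0 XX' mf f0.
have mEf : measurable_fun setT (EFin \o f) by exact/measurable_EFinP.
rewrite -!(integral_pushforward_mrestr _ _ mEf)//.
have -> : k%:E = (NngNum k0)%:num%:E by [].
rewrite -ge0_integral_mscale//; last by move=> y _; rewrite lee_fin.
by apply: eq_measure_integral => A mA _; exact: XX'.
Qed.

(** A product formula on rectangles extends to the joint law by uniqueness of the product measure,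
    and Tonelli separates the factors. In the application [E] is [F] together with an independent
    arrival of probability [k]. *)
Lemma integral_indep_prod (X Y : {mfun T >-> R}) (E F : set T) (k : R)
    (f g : R -> R) : measurable E -> measurable F -> 0 <= k ->
  (forall A C, measurable A -> measurable C ->
    P (X @^-1` A `&` Y @^-1` C `&` E)
      = (k%:E * P (X @^-1` A `&` F) * P (Y @^-1` C))%E) ->
  measurable_fun setT f -> (forall y, 0 <= f y) ->
  measurable_fun setT g -> (forall y, 0 <= g y) ->
  (\int[P]_(w in E) (f (X w) * g (Y w))%:E
    = k%:E * \int[P]_(w in F) (f (X w))%:E * \int[P]_w (g (Y w))%:E)%E.
Proof.
move=> mE mF k0 XY mf f0 mg g0.
have mEf : measurable_fun setT (EFin \o f) by exact/measurable_EFinP.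
have mEg : measurable_fun setT (EFin \o g) by exact/measurable_EFinP.
pose kn := NngNum k0.
(* The factor [k] and the event [F] are absorbed into the law of [X], so that the joint law on [E]
   is a product of two finite measures. *)
pose m1_ : {measure set R -> \bar R} :=
  mscale kn (pushforward (mrestr P mF) X).
pose m1 := m1_ (measurable_funPT X).
pose m2_ : {measure set R -> \bar R} := pushforward P Y.
pose m2 := m2_ (measurable_funPT Y).
have m1fin : fin_num_fun m1.
  move=> A mA; rewrite /m1/= /mscale/= fin_numM//.
  rewrite /pushforward/= /mrestr fin_num_measure//.
  by apply: measurableI => //; exact: measurable_funPTI.
have m2fin : fin_num_fun m2.
  by move=> A mA; rewrite /m2/= /pushforward fin_num_measure//; exact: measurable_funPTI.
pose m1s : {finite_measure set R -> \bar R} :=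
  HB.pack (Measure.sort m1) (Measure_isFinite.Build _ _ _ m1 m1fin).
pose m2s : {finite_measure set R -> \bar R} :=
  HB.pack (Measure.sort m2) (Measure_isFinite.Build _ _ _ m2 m2fin).
pose XYf (w : T) : R * R := (X w, Y w).
have mXY : measurable_fun setT XYf by exact/measurable_fun_pair.
pose h (z : R * R) : \bar R := (f z.1 * g z.2)%:E.
have mh : measurable_fun setT h.
  apply/measurable_EFinP; apply: measurable_funM.
  - exact: (measurableT_comp mf measurable_fst).
  - exact: (measurableT_comp mg measurable_snd).
have h0 z : (0 <= h z)%E by rewrite lee_fin mulr_ge0.
rewrite -(integral_pushforward_mrestr mE mXY mh h0).
transitivity (\int[(m1s \x m2s)%E]_z h z)%E.
  apply: eq_measure_integral => A mA _; apply/esym.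
  exact: (@product_measure_unique _ _ _ _ _ m1s m2s).
rewrite fubini_tonelli1//.
transitivity (\int[m1s]_x ((f x)%:E * \int[m2s]_y (g y)%:E))%E.
  apply: eq_integral => x _.
  rewrite -ge0_integralZl//; last by rewrite lee_fin.
  by move=> y _; rewrite lee_fin.
rewrite ge0_integralZr//; last 2 first.
  by move=> y _; rewrite lee_fin.
  by apply: integral_ge0 => y _; rewrite lee_fin.
congr (_ * _)%E; last first.
  by rewrite /m2s/= /m2 ge0_integral_pushforward// => y _; rewrite lee_fin.
rewrite /m1s/= /m1 ge0_integral_mscale//; last by move=> y _; rewrite lee_fin.
congr (_ * _)%E.
by rewrite integral_pushforward_mrestr// => y; rewrite lee_fin.
Qed.

End restricted_expectation.

(** * Workload paths *)

Section total_over_customers_theory.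
Context (R : realType) (D : nat).
Implicit Types f g : customer D -> R.

Lemma le_total_over_customers f k :
  (forall k', 0 <= f k') -> ((f k)%:E <= total_over_customers f)%E.
Proof.
move=> f0; case: k => j n; rewrite /total_over_customers (bigD1 j)//=.
have sum0 (i : option 'I_D) : (0 <= \sum_(0 <= m <oo) (f (i, m))%:E)%E.
  by apply: nneseries_ge0 => m _ _; rewrite lee_fin.
apply: (@le_trans _ _ (\sum_(0 <= m <oo) (f (j, m))%:E)%E); last first.
  by rewrite leeDl// sume_ge0.
apply: le_trans (nneseries_lim_ge n.+1 _); last first.
  by move=> m _ _; rewrite lee_fin.
by rewrite big_nat_recr//= leeDr// sume_ge0// => m _; rewrite lee_fin.
Qed.

Lemma total_over_customers_ge0 f :
  (forall k, 0 <= f k) -> (0 <= total_over_customers f)%E.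
Proof.
move=> f0; apply: sume_ge0 => j _.
by apply: nneseries_ge0 => m _ _; rewrite lee_fin.
Qed.

Lemma total_over_customersD f g : (forall k, 0 <= f k) ->
  (forall k, 0 <= g k) -> total_over_customers (fun k => f k + g k)
    = (total_over_customers f + total_over_customers g)%E.
Proof.
move=> f0 g0; rewrite /total_over_customers -big_split/=.
apply: eq_bigr => j _; under eq_eseriesr do rewrite EFinD.
by rewrite nneseriesD// => m _ _; rewrite lee_fin.
Qed.

Lemma total_over_customersZ (x : R) f : 0 <= x -> (forall k, 0 <= f k) ->
  total_over_customers (fun k => x * f k) = (x%:E * total_over_customers f)%E.
Proof.
move=> x0 f0; rewrite /total_over_customers ge0_sume_distrr//; last first.
  by move=> j _; apply: nneseries_ge0 => m _ _; rewrite lee_fin.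
apply: eq_bigr => j _; under eq_eseriesr do rewrite EFinM.
by rewrite nneseriesZl// => m _; rewrite lee_fin.
Qed.

Lemma integral_total_over_customers d (T : measurableType d)
    (mu : {measure set T -> \bar R}) (E : set T) (F : customer D -> T -> R) :
  measurable E -> (forall k, measurable_fun E (F k)) ->
  (forall k x, E x -> 0 <= F k x) ->
  (\int[mu]_(x in E) total_over_customers (F ^~ x)
   = \sum_(j : option 'I_D) \sum_(0 <= n <oo) \int[mu]_(x in E) (F (j, n) x)%:E)%E.
Proof.
move=> mE mF F0; rewrite /total_over_customers ge0_integral_sum//.
- apply: eq_bigr => j _; rewrite integral_nneseries// => n.
    exact/measurable_EFinP.
  by move=> x Ex; rewrite lee_fin F0.
- move=> j; apply: ge0_emeasurable_sum => n x.
    by move=> Ex _; rewrite lee_fin F0.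
  exact/measurable_EFinP.
- by move=> j x Ex; apply: nneseries_ge0 => n _ _; rewrite lee_fin F0.
Qed.

End total_over_customers_theory.

(** * Balance of work along a trajectory *)

Section workload_path.
Context d (T : measurableType d) (dS : measure_display) (S : measurableType dS).
Variables (R : realType) (D : nat) (P : probability T R).
Variables (lambda c : 'I_D -> R) (Hc : forall i, 0 <= c i).
Variables (X0 : {mfun T >-> S}) (Z : R -> T -> 'I_D).
Variables (V B : 'I_D -> nat -> {RV P >-> R}) (b : nat -> {mfun S >-> R}).
Variables (phi : discipline R D S) (Hphi : service_discipline phi).
Variables (r : R -> T -> customer D -> R).
Hypothesis Hr : queue_dynamics lambda c X0 Z V B b phi r.
Variables (W : R -> {RV P >-> R}) (HW : is_workload r W).

Let rate k t w := service_rate c X0 Z phi r k t w.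
Let brought := work_brought lambda X0 Z V B b.

Definition busy_capacity (w : T) (s : R) : R :=
  if 0 < W s w then c (Z s w) else 0.

Lemma workload_ge0 t w : 0 <= t -> 0 <= W t w.
Proof.
move=> t0; rewrite -lee_fin HW//; apply: total_over_customers_ge0 => k.
exact: (residual_ge0 Hr).
Qed.

Lemma workload_gt0P t w : 0 <= t -> (exists k, 0 < r t w k) <-> 0 < W t w.
Proof.
move=> t0; split=> [[k rk]|W0].
  rewrite -lte_fin HW//.
  apply: (@lt_le_trans _ _ (r t w k)%:E); first by rewrite lte_fin.
  by apply: le_total_over_customers => k'; exact: (residual_ge0 Hr).
apply: contrapT => nex.
have r0 k : r t w k = 0.
  apply/eqP; rewrite eq_le (residual_ge0 Hr)// andbT leNgt.
  by apply/negP => rk; apply: nex; exists k.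
suff : (W t w)%:E = 0%E by case=> Wt0; rewrite Wt0 ltxx in W0.
rewrite HW// /total_over_customers big1// => j _.
by rewrite eseries0// => n _ _; rewrite r0.
Qed.

Lemma service_rate_ge0 k s w : 0 <= s -> 0 <= rate k s w.
Proof. by move=> s0; rewrite mulr_ge0// (discipline_ge0 Hphi). Qed.

(** The point where [phi] disappears: a non-empty queue uses the full capacity by work conservation,
    an empty one uses none because absent customers get no service. *)
Lemma total_service_rate s w : 0 <= s ->
  total_over_customers (fun k => rate k s w) = (busy_capacity w s)%:E.
Proof.
move=> s0; rewrite /rate /service_rate total_over_customersZ//; last first.
  by move=> k; rewrite (discipline_ge0 Hphi).
rewrite /busy_capacity; case: ifPn => [/(workload_gt0P _ s0) ex|nW].
  by rewrite (discipline_work_conserving Hphi)// ?mule1//; exact: (residual_finite Hr).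
have phi0 k : phi (X0 w) (r ^~ w) s k = 0.
  rewrite (discipline_absent Hphi)// leNgt; apply/negP => rk.
  by move/negP: nW; apply; apply/(workload_gt0P _ s0); exists k.
rewrite /total_over_customers big1 ?mule0// => j _.
by rewrite eseries0// => n _ _; rewrite phi0.
Qed.

Let cbar := \sum_i c i.

Lemma capacity_le_sum i : c i <= cbar.
Proof. by rewrite /cbar (bigD1 i)//= lerDl sumr_ge0. Qed.

Let cbar_ge0 : 0 <= cbar. Proof. exact: sumr_ge0. Qed.

Lemma busy_capacity_bounds w s : 0 <= busy_capacity w s <= cbar.
Proof.
by rewrite /busy_capacity; case: ifP => _; rewrite ?lexx ?Hc ?capacity_le_sum.
Qed.

Let itv0P (t s : R) : `[0, t]%classic s -> 0 <= s.
Proof. by rewrite /= in_itv/= => /andP[]. Qed.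

(** Nothing is known about how [W] depends on time; measurability is inherited from the service
    rates, whose countable sum this function is. *)
Lemma measurable_busy_capacity w t : measurable_fun (`[0, t] : set R) (busy_capacity w).
Proof.
apply/measurable_EFinP.
apply: (eq_measurable_fun (fun s => total_over_customers (fun k => rate k s w))).
  by move=> s; rewrite inE => /itv0P s0; rewrite total_service_rate.
apply: emeasurable_sum => j; apply: ge0_emeasurable_sum => n s.
  by move=> /itv0P s0 _; rewrite lee_fin service_rate_ge0.
apply/measurable_EFinP; apply: measurable_funS (service_measurable Hr w (j, n)) => // u /=.
by rewrite !in_itv/= andbT => /andP[].
Qed.

Let lebesgue_itv (t : R) : 0 <= t -> lebesgue_measure (`[0, t] : set R) = t%:E.
Proof.
move=> t0; rewrite lebesgue_measure_itv/= lte_fin.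
by case: ifPn => [_|]; [rewrite sube0|rewrite -leNgt => t1; congr EFin; apply/le_anti/andP].
Qed.

Lemma integrable_bounded_itv (g : R -> R) (t M : R) : 0 <= t ->
  measurable_fun (`[0, t] : set R) g -> (forall s, 0 <= s <= t -> 0 <= g s <= M) ->
  lebesgue_measure.-integrable (`[0, t] : set R) (EFin \o g).
Proof.
move=> t0 mg gM; apply: measurable_bounded_integrable => //.
  by have /= -> := lebesgue_itv t0; rewrite ltry.
exists M; split; rewrite ?num_real// => x Mx y /=.
rewrite in_itv/= => /gM/andP[g0 gM']; rewrite ger0_norm//.
exact: le_trans gM' (ltW Mx).
Qed.

Let served w t := \int[lebesgue_measure]_(s in `[0, t]) busy_capacity w s.

Lemma integral_busy_capacity w t : 0 <= t -> (served w t)%:E =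
  (\int[lebesgue_measure]_(s in `[0%R, t]) (busy_capacity w s)%:E)%E.
Proof.
move=> t0; rewrite /served /Rintegral fineK//.
apply: integrable_fin_num => //.
apply: (@integrable_bounded_itv _ _ cbar) => //; first exact: measurable_busy_capacity.
by move=> s _; exact: busy_capacity_bounds.
Qed.

Lemma served_bounds w t : 0 <= t -> 0 <= served w t <= cbar * t.
Proof.
move=> t0; rewrite Rintegral_ge0/=; last first.
  by move=> s _; case/andP: (busy_capacity_bounds w s).
have -> : cbar * t = \int[lebesgue_measure]_(s in `[0, t]) cbar.
  by rewrite Rintegral_cst//; have /= -> := lebesgue_itv t0.
apply: le_Rintegral => //.
- apply: (@integrable_bounded_itv _ _ cbar) => //; first exact: measurable_busy_capacity.
  by move=> s _; exact: busy_capacity_bounds.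
- by apply: (@integrable_bounded_itv _ _ cbar) => // s _; rewrite lexx cbar_ge0.
- by move=> s _; case/andP: (busy_capacity_bounds w s).
Qed.

(** [residualE] summed over all customers, with the sum and the time integral exchanged by Tonelli.
    The sign of the work brought is a consequence: it is a residual plus the service received. *)
Lemma workload_balance w t : 0 <= t -> (forall k, 0 <= brought k t w) /\
  total_over_customers (fun k => brought k t w) = (W t w + served w t)%:E.
Proof.
move=> t0.
pose I k := \int[lebesgue_measure]_(s in `[0, t]) rate k s w.
have I0 k : 0 <= I k.
  by apply: Rintegral_ge0 => s /itv0P s0; exact: service_rate_ge0.
have E k : brought k t w = r t w k + I k by rewrite (residualE Hr)// subrK.
split=> [k|]; first by rewrite E addr_ge0// (residual_ge0 Hr).
under [X in total_over_customers X]eq_fun do rewrite E.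
rewrite total_over_customersD//; last by move=> k; exact: (residual_ge0 Hr).
rewrite EFinD HW//; congr (_ + _)%E.
have mrate k : measurable_fun (`[0, t] : set R) (rate k ^~ w).
  apply: measurable_funS (service_measurable Hr w k) => // u /=.
  by rewrite !in_itv/= andbT => /andP[].
rewrite integral_busy_capacity//.
transitivity (\int[lebesgue_measure]_(s in `[0%R, t])
    total_over_customers (fun k => rate k s w))%E; last first.
  by apply: eq_integral => s; rewrite inE => /itv0P s0; rewrite total_service_rate.
have rate0 k s : `[0, t]%classic s -> 0 <= rate k s w.
  by move=> /itv0P s0; exact: service_rate_ge0.
have mitv : measurable (`[0, t]%classic : set R) by [].
apply/esym/(etrans (integral_total_over_customers lebesgue_measure mitv mrate
  rate0))/esym.
apply: eq_bigr => j _; apply: eq_eseriesr => n _.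
(* A single rate is at most the total rate, hence at most [cbar], so its integral is finite. *)
rewrite /I /Rintegral fineK//; apply: integrable_fin_num => //.
apply: (@integrable_bounded_itv _ _ cbar) => //.
move=> s /andP[s0 _]; rewrite service_rate_ge0//= -lee_fin.
apply: (@le_trans _ _ (total_over_customers (fun k => rate k s w))).
  apply: (@le_total_over_customers _ _ (fun k => rate k s w)) => k.
  exact: service_rate_ge0.
by rewrite total_service_rate// lee_fin; case/andP: (busy_capacity_bounds w s).
Qed.

(** An almost sure event, on which every arrival epoch is positive. *)
Definition positive_interarrivals : set T :=
  [set w | forall i n, 0 < lambda i -> 0 < V i n w].

Lemma arrival_epoch_gt0 w i n : positive_interarrivals w -> 0 < lambda i ->
  0 < arrival_epoch V i n w.
Proof.
move=> Vw li; rewrite /arrival_epoch big_ord_recl ltr_wpDr ?Vw//.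
by apply: sumr_ge0 => m _; rewrite ltW ?Vw.
Qed.

Lemma arrival_epoch_ge w i n m : positive_interarrivals w -> 0 < lambda i ->
  (m <= n)%N -> V i m w <= arrival_epoch V i n w.
Proof.
move=> Vw li mn; rewrite /arrival_epoch (bigD1 (Ordinal (mn : (m < n.+1)%N)))//=.
by rewrite lerDl sumr_ge0// => j _; rewrite ltW ?Vw.
Qed.

Let arrivals w t := (\sum_i \sum_(0 <= n <oo) (brought (Some i, n) t w)%:E)%E.

(** At time 0 no epoch has occurred, since all are positive, so the initial customers account for
    the whole of [W 0]. They contribute the same amount to the balance at time [t], and the rest is
    due to arrivals. *)
Lemma workload_balance0 w t : positive_interarrivals w -> 0 <= t ->
  [/\ (W 0 w)%:E = (\sum_(0 <= n <oo) (b n (X0 w))%:E)%E ,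
     (0 <= arrivals w t)%E &
     (W 0 w)%:E + arrivals w t = (W t w + served w t)%:E]%E.
Proof.
move=> Vw t0.
have split_total s : total_over_customers (fun k => brought k s w)
    = (\sum_(0 <= n <oo) (b n (X0 w))%:E + arrivals w s)%E.
  rewrite /total_over_customers (bigD1 None)//=; congr (_ + _)%E.
  rewrite /arrivals (reindex_omap Some id)/=; last by case.
  by apply: eq_bigl => i; rewrite eqxx.
have W0E : (W 0 w)%:E = (\sum_(0 <= n <oo) (b n (X0 w))%:E)%E.
  have [_] := workload_balance w (lexx 0).
  rewrite split_total /served set_itv1 Rintegral_set1 addr0 => <-.
  rewrite /arrivals big1 ?adde0// => i _; rewrite eseries0// => n _ _.
  rewrite /brought/= /arrived_by; case: ifP => // /and3P[li].
  by rewrite leNgt arrival_epoch_gt0.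
have [br0 E] := workload_balance w t0.
split=> //; last by rewrite W0E -split_total.
apply: sume_ge0 => i _; apply: nneseries_ge0 => n _ _; by rewrite lee_fin.
Qed.

Lemma workload_ge w t : positive_interarrivals w -> 0 <= t ->
  W 0 w - cbar * t <= W t w.
Proof.
move=> Vw t0; have [_ a0 E] := workload_balance0 Vw t0.
have /andP[_ s1] := served_bounds w t0.
have : ((W 0 w)%:E <= (W t w + served w t)%:E)%E by rewrite -E leeDl.
by rewrite lee_fin; lra.
Qed.

Lemma workload_no_arrival w t : positive_interarrivals w -> 0 <= t ->
  (forall i, 0 < lambda i -> t < V i 0%N w) -> W 0 w = W t w + served w t.
Proof.
move=> Vw t0 noarr; have [_ _] := workload_balance0 Vw t0.
rewrite /arrivals big1 ?adde0 => [[]//|i _].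
rewrite eseries0// => n _ _; rewrite /brought/= /arrived_by.
case: ifP => // /and3P[li]; rewrite leNgt => /negP; case.
exact: lt_le_trans (noarr _ li) (arrival_epoch_ge Vw li (leq0n n)).
Qed.

Lemma workload_no_arrival_le w t : positive_interarrivals w -> 0 <= t ->
  (forall i, 0 < lambda i -> t < V i 0%N w) -> W t w <= W 0 w.
Proof.
move=> Vw t0 /(workload_no_arrival Vw t0) ->.
by rewrite lerDl; case/andP: (served_bounds w t0).
Qed.

(** A workload above [cbar * t] cannot run out before [t], so the server works at the constant rate
    [c (Z 0 w)] throughout. *)
Lemma workload_drift w t : positive_interarrivals w -> 0 <= t ->
  (forall i, 0 < lambda i -> t < V i 0%N w) ->
  (forall s, 0 <= s <= t -> Z s w = Z 0 w) -> cbar * t < W 0 w ->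
  W t w = W 0 w - c (Z 0 w) * t.
Proof.
move=> Vw t0 noarr Zc Wt; rewrite (workload_no_arrival Vw t0 noarr).
have -> : served w t = \int[lebesgue_measure]_(s in `[0, t]) c (Z 0 w).
  apply: eq_Rintegral => s; rewrite inE/= in_itv/= => /[dup] st /andP[s0 st'].
  rewrite /busy_capacity Zc// ifT//.
  have := workload_ge Vw s0.
  have : cbar * s <= cbar * t by rewrite ler_wpM2l.
  lra.
by rewrite Rintegral_cst//; have /= -> := lebesgue_itv t0; rewrite addrK.
Qed.

(** In a constant environment customers of other streams do not enter. Any epoch of index at least 1
    bounds both of the first two interarrival times, so the hypothesis leaves at most the customer
    of index 0. *)
Lemma workload_one_arrival w t : positive_interarrivals w -> 0 <= t ->
  (forall s, 0 <= s <= t -> Z s w = Z 0 w) ->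
  ~ (0 < lambda (Z 0 w) /\ V (Z 0 w) 0%N w <= t /\ V (Z 0 w) 1%N w <= t) ->
  let J := if (0 < lambda (Z 0 w)) && (V (Z 0 w) 0%N w <= t)
           then B (Z 0 w) 0%N w else 0 in
  [/\ 0 <= J, W 0 w + J - cbar * t <= W t w & W t w <= W 0 w + J].
Proof.
move=> Vw t0 Zc no2 J; have [_ _] := workload_balance0 Vw t0.
have /andP[s0 s1] := served_bounds w t0.
have br0 := (workload_balance w t0).1.
have JE : brought (Some (Z 0 w), 0%N) t w = J.
  rewrite /brought/= /arrived_by /J /arrival_epoch big_ord1.
  case: (ltP 0 (lambda (Z 0 w))) => //= li.
  case: (leP (V (Z 0 w) 0%N w) t) => //= Vt.
  by rewrite Zc ?eqxx// Vt ltW ?Vw.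
have -> : arrivals w t = J%:E.
  rewrite /arrivals (bigD1 (Z 0 w))//= [X in (_ + X)%E]big1 ?adde0; last first.
    move=> i nZ; rewrite eseries0// => n _ _; rewrite /brought/= /arrived_by.
    case: ifP => // /and3P[li Tt]; rewrite Zc; first by rewrite eq_sym (negbTE nZ).
    by rewrite Tt ltW// arrival_epoch_gt0.
  rewrite (@nneseriesD1 _ _ 0%N)//; last first.
    by move=> n *; rewrite lee_fin; exact: (br0 (Some (Z 0 w), n)).
  move: JE; rewrite /brought/= => ->.
  rewrite [X in (_ + X)%E]eseries0 ?adde0// => n _ /= n0.
  rewrite /brought/= /arrived_by; case: ifP => // /and3P[li Tt _].
  case: no2; split=> //; split.
    exact: le_trans (arrival_epoch_ge Vw li (leq0n n)) Tt.
  by apply: le_trans Tt; apply: arrival_epoch_ge => //; rewrite lt0n.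
rewrite -EFinD => -[E]; split; [by rewrite -JE br0|lra|lra].
Qed.

End workload_path.

(** * Independence and events of the environment *)

Lemma mutually_independent2 d (T : measurableType d) (R : realType)
    (P : probability T R) (I : eqType) (F : I -> set (set T)) (i j : I)
    (A B : set T) : mutually_independent P F -> i != j -> F i A -> F j B ->
  P (A `&` B) = (P A * P B)%E.
Proof.
move=> indep ij FA FB.
pose E k := if k == i then A else B.
have := indep [:: i; j] E; rewrite /= inE ij => /(_ isT).
rewrite !big_cons big_nil mule1 /E eqxx (eq_sym j) (negbTE ij) => <-.
  congr (P _); apply/seteqP; split=> [w [Aw Bw] k|w h].
    by rewrite /= !inE => /orP[]/eqP->; rewrite ?eqxx// eq_sym (negbTE ij).
  split; first by have := h i; rewrite /= !inE !eqxx; apply.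
  by have := h j; rewrite /= !inE !eqxx orbT (eq_sym j) (negbTE ij); apply.
by move=> k; rewrite !inE => /orP[]/eqP->; rewrite ?eqxx// eq_sym (negbTE ij).
Qed.

Lemma mutually_independent3 d (T : measurableType d) (R : realType)
    (P : probability T R) (I : eqType) (F : I -> set (set T)) (i j k : I)
    (A B C : set T) : mutually_independent P F ->
  i != j -> i != k -> j != k -> F i A -> F j B -> F k C ->
  P (A `&` B `&` C) = (P A * P B * P C)%E.
Proof.
move=> indep ij ik jk FA FB FC.
have [ji ki kj] : [/\ j == i = false, k == i = false & k == j = false].
  by split; rewrite eq_sym; apply/negbTE.
pose E l := if l == i then A else if l == j then B else C.
have := indep [:: i; j; k] E; rewrite /= !inE negb_or ij ik jk => /(_ isT).
rewrite !big_cons big_nil mule1 /E !eqxx ji ki kj muleA => <-.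
  congr (P _); apply/seteqP; split=> [w [[Aw Bw] Cw] l|w h].
    by rewrite /= !inE => /or3P[]/eqP->; rewrite ?eqxx ?ji ?ki ?kj.
  split; first split.
  - by have := h i; rewrite /= !inE !eqxx; apply.
  - by have := h j; rewrite /= !inE !eqxx orbT ji; apply.
  - by have := h k; rewrite /= !inE !eqxx !orbT ki kj; apply.
by move=> l; rewrite !inE => /or3P[]/eqP->; rewrite ?eqxx ?ji ?ki ?kj.
Qed.

Lemma measure_eq_outside d (T : measurableType d) (R : realType)
    (P : probability T R) (N A B : set T) : measurable N -> P N = 0%E ->
  measurable A -> measurable B -> (forall w, ~ N w -> A w <-> B w) -> P A = P B.
Proof.
move=> mN PN mA mB AB.
have E (C : set T) : measurable C -> P C = P (C `\` N).
  move=> mC; rewrite -(setUIDK C N) measureU//; last 3 first.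
  - exact: measurableI.
  - exact: measurableD.
  - by rewrite setDE setIACA setICr setI0.
  rewrite setUIDK [X in (X + _)%E](_ : _ = 0%E) ?add0e//.
  apply/eqP; rewrite eq_le measure_ge0 andbT -PN.
  by apply: le_measure; rewrite ?inE//; exact: measurableI.
rewrite E// [RHS]E//; congr (P _).
by apply/seteqP; split=> w [Cw nN]; split=> //; apply/AB.
Qed.

Section exponential_law.
Context d (T : measurableType d) (R : realType) (P : probability T R).
Variables (V : {RV P >-> R}) (l : R).
Hypothesis VE : forall A, measurable A -> P (V @^-1` A) = exponential_prob l A.

Lemma exponential_law_le0 : P [set w | V w <= 0] = 0%E.
Proof.
have -> : [set w | V w <= 0] = V @^-1` `]-oo, 0[ `|` V @^-1` [set 0].
  apply/seteqP; split=> w /=; rewrite in_itv/= le_eqVlt.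
    by case/predU1P; [right|left].
  by case=> [->|->]; rewrite ?orbT// eqxx.
have dis : V @^-1` `]-oo, 0[ `&` V @^-1` [set 0] = set0.
  by apply/seteqP; split=> w //= -[]; rewrite in_itv/= => /[swap] ->; rewrite ltxx.
transitivity (P (V @^-1` `]-oo, 0%R[) + P (V @^-1` [set 0%R]))%E.
  by apply: measureU => //; exact: (measurable_funPTI V).
rewrite !VE// /exponential_prob integral_set1 adde0.
rewrite integral0_eq// => x; rewrite /= in_itv/= => x0.
by rewrite lt0_exponential_pdf.
Qed.

(** The formula at hand is for [[0, h]]; the two events differ only where [V] is nonpositive, which
    has probability 0. *)
Lemma exponential_law_le h : 0 < h ->
  P [set w | V w <= h] = (1 - expR (- l * h))%:E.
Proof.
move=> h0; have := VE (A := `[0, h]%classic); rewrite exponential_prob_itv0c//.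
rewrite EFinB => <-//.
apply: (@measure_eq_outside _ _ _ _ [set w | V w <= 0]).
- have -> : [set w | V w <= 0] = V @^-1` `]-oo, 0].
    by apply/seteqP; split=> w /=; rewrite in_itv.
  exact: (measurable_funPTI V).
- exact: exponential_law_le0.
- have -> : [set w | V w <= h] = V @^-1` `]-oo, h].
    by apply/seteqP; split=> w /=; rewrite in_itv.
  exact: (measurable_funPTI V).
- exact: (measurable_funPTI V).
- move=> w /= /negP; rewrite -ltNge in_itv/= => w0; by rewrite (ltW w0).
Qed.

End exponential_law.

Section environment_theory.
Context d (T : measurableType d) (dS : measure_display) (S : measurableType dS).
Variables (R : realType) (D : nat) (P : probability T R) (Q : 'M[R]_D).
Variables (X0 : {mfun T >-> S}) (Z : R -> T -> 'I_D).
Hypothesis HZ : markov_environment P Q X0 Z.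
Variables (J : set R) (J0 : forall u, J u -> 0 <= u).

(** Repeats the generators of [environment_events], whose members are then by conversion the
    measurable sets of [g_sigma_algebraType gen]; closure lemmas for measurable sets apply to
    them. *)
Let gen := [set E | (exists2 A, measurable A & E = X0 @^-1` A) \/
               (exists u i, J u /\ E = Z u @^-1` [set i])].

Lemma environment_event_measurable E :
  environment_events X0 Z J E -> measurable E.
Proof.
apply: smallest_sub; first exact: sigma_algebra_measurable.
move=> _ [[A mA ->]|[u [i [Ju ->]]]]; first exact: measurable_funPTI.
exact: (environment_measurable HZ _ (J0 Ju)).
Qed.

Lemma environment_event_state u i : J u ->
  environment_events X0 Z J [set w | Z u w = i].
Proof. by move=> Ju; apply: sub_sigma_algebra; right; exists u, i. Qed.

Lemma environment_event_initial A : measurable A ->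
  environment_events X0 Z J (X0 @^-1` A).
Proof. by move=> mA; apply: sub_sigma_algebra; left; exists A. Qed.

Lemma environment_eventI A B : environment_events X0 Z J A ->
  environment_events X0 Z J B -> environment_events X0 Z J (A `&` B).
Proof. exact: (@measurableI _ (g_sigma_algebraType gen)). Qed.

Lemma environment_event_differs u v : J u -> J v ->
  environment_events X0 Z J [set w | Z u w <> Z v w].
Proof.
move=> Ju Jv.
have -> : [set w | Z u w <> Z v w] =
    ~` \bigcup_(i in [set: 'I_D]) ([set w | Z u w = i] `&` [set w | Z v w = i]).
  congr (~` _); apply/seteqP; split=> w /=.
    by move=> E; exists (Z u w) => //; split.
  by case=> i _ [-> ->].
apply: (@measurableC _ (g_sigma_algebraType gen)).
apply: (@fin_bigcup_measurable _ (g_sigma_algebraType gen)) => // i _.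
by apply: environment_eventI; exact: environment_event_state.
Qed.

End environment_theory.

Lemma at_rightP (R : realType) (t : R) (p : set R) :
  (\forall s \near t^'+, p s) ->
  exists2 e : R, 0 < e & forall u, t < u < t + e -> p u.
Proof.
move=> /nbhs_ballP[e /= e0 He]; exists e => // u /andP[tu ute].
by apply: He => //=; rewrite /ball/= distrC gtr0_norm ?subr_gt0// ltrBlDl.
Qed.

Lemma measure_fin_bigcup_le d (T : measurableType d) (R : realType)
    (mu : probability T R) (I : finType) (A : I -> set T) :
  (forall i, measurable (A i)) ->
  (mu (\bigcup_(i in [set: I]) A i) <= \sum_i mu (A i))%E.
Proof.
move=> mA; have -> : \bigcup_(i in [set: I]) A i = \big[setU/set0]_i A i.
  apply/seteqP; split=> [w [i _ Aw]|]; first by rewrite (bigD1 i)//=; left.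
  by elim/big_ind: _ => // [X Y XU YU w [/XU|/YU]//|i _ w Aw]; exists i.
suff [] : measurable (\big[setU/set0]_i A i) /\
    (mu (\big[setU/set0]_i A i) <= \sum_i mu (A i))%E by [].
elim/big_ind2: _ => [|X x Y y [mX Xx] [mY Yy]|i _]; last by split.
  by rewrite measure0.
split; first exact: measurableU.
by apply: le_trans (measureU2 _ mX mY) _; exact: leeD.
Qed.

(** * Jumps and arrivals in a short interval *)

Section queue_events.
Context d (T : measurableType d) (dS : measure_display) (S : measurableType dS).
Variables (R : realType) (D : nat) (P : probability T R) (Q : 'M[R]_D).
Variables (lambda : 'I_D -> R) (H : 'I_D -> probability (measurableTypeR R) R).
Variables (X0 : {mfun T >-> S}) (Z : R -> T -> 'I_D).
Variables (V B : 'I_D -> nat -> {RV P >-> R}).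
Hypothesis Hlambda : forall i, 0 <= lambda i.
Hypothesis HZ : markov_environment P Q X0 Z.
Hypothesis Hin : modulated_input lambda H X0 Z V B.

(** Every time in the interval is compared with time 0, so an excursion that is back at [h] counts
    as well. *)
Definition environment_jump (h : R) : set T :=
  [set w | exists2 s, 0 <= s <= h & Z s w <> Z 0 w].

Lemma environment_jump_event h : 0 <= h ->
  environment_events X0 Z `[0, +oo[ (environment_jump h).
Proof.
(* Right continuity lets rational times suffice before [h], but a change at [h] itself may be
   invisible at earlier times. Clamping keeps all rationals inside the interval and reaches [h]
   exactly, from any rational above it. *)
move=> h0; pose clamp (q : rat) : R := Num.min (Num.max (ratr q) 0) h.
have clamp0 q : 0 <= clamp q by rewrite le_min h0 le_max lexx orbT.
have clamph q : clamp q <= h by rewrite ge_min lexx orbT.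
have -> : environment_jump h = \bigcup_(q in [set: rat]) [set w | Z (clamp q) w <> Z 0 w].
  apply/seteqP; split=> w /=; last first.
    by case=> q _ /= neq; exists (clamp q); rewrite ?clamp0 ?clamph.
  case=> s /andP[s0]; rewrite le_eqVlt => /predU1P[-> neq|sh neq].
    have [q] := rat_in_itvoo (ltr_pwDr ltr01 (lexx h)).
    rewrite in_itv/= => /andP[hq _]; exists q => //=.
    suff -> : clamp q = h by [].
    by rewrite /clamp min_r// le_max (ltW hq).
  have /at_rightP[e e0 He] := environment_right_continuous HZ w s0.
  have sm : s < Num.min (s + e) h by rewrite lt_min sh ltrDl e0.
  have [q] := rat_in_itvoo sm; rewrite in_itv/= lt_min => /and3P[sq qe qh].
  exists q => //=.
  have -> : clamp q = ratr q.
    by rewrite /clamp max_l ?(le_trans s0 (ltW sq))// min_l// ltW.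
  by rewrite He// sq qe.
apply: (@bigcupT_measurable_rat _ (g_sigma_algebraType _)) => q.
by apply: environment_event_differs; rewrite /= in_itv/= ?clamp0 ?lexx.
Qed.

Lemma measurable_environment_jump h : 0 <= h -> measurable (environment_jump h).
Proof.
move=> h0; apply: (environment_event_measurable HZ) (environment_jump_event h0).
by move=> u; rewrite /= in_itv/= andbT.
Qed.

(** By right continuity at 0 these events decrease to the empty set. The limit comes without a rate,
    which is enough because the one-step error multiplies this probability by [h]. *)
Lemma cvg_environment_jump :
  fine (P (environment_jump n.+1%:R^-1)) @[n --> \oo] --> (0 : R).
Proof.
have cap0 : \bigcap_n environment_jump n.+1%:R^-1 = set0.
  apply/seteqP; split=> w // jw.
  have /at_rightP[e e0 He] := environment_right_continuous HZ w (lexx 0).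
  have [n] : exists n : nat, n.+1%:R^-1 < e.
    have [n _ /(_ n (leqnn n)) nE] : \forall n \near \oo, n.+1%:R^-1 < e.
      exact: (cvgr_lt 0 (@cvg_harmonic R)).
    by exists n.
  move=> ne; have [s /andP[s0 sn]] := jw n I; apply.
  move: s0; rewrite le_eqVlt => /predU1P[<-//|s0].
  by apply: He; rewrite s0 add0r (le_lt_trans sn).
have : (P \o (fun n => environment_jump n.+1%:R^-1)) n @[n --> \oo]
    --> P (\bigcap_n environment_jump n.+1%:R^-1).
  apply: nonincreasing_cvg_mu.
  - by rewrite ltey_eq fin_num_measure//; exact: measurable_environment_jump.
  - by move=> n; exact: measurable_environment_jump.
  - by rewrite cap0.
  - move=> n m nm; apply/subsetPset => w [s /andP[s0 sm] neq].
    by exists s => //; rewrite s0 (le_trans sm)// lef_pV2 ?posrE// ler_nat.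
by rewrite cap0 measure0 => /fine_cvgP[].
Qed.

(** The bound is on an interarrival time, not on an epoch, so that distinct [n] give independent
    events. The rate must be positive because the law of [V i n] is prescribed only then. *)
Definition arrival_within (i : 'I_D) (n : nat) (h : R) : set T :=
  [set w | 0 < lambda i /\ V i n w <= h].

Lemma arrival_withinE i n h : arrival_within i n h
  = V i n @^-1` (if 0 < lambda i then `]-oo, h]%classic else set0).
Proof.
apply/seteqP; split=> w; rewrite /arrival_within/=.
  by case=> -> ?; rewrite /= in_itv.
by case: ifP => // li; rewrite /= in_itv.
Qed.

Lemma measurable_arrival_within i n h : measurable (arrival_within i n h).
Proof.
rewrite arrival_withinE; apply: (measurable_funPTI (V i n)).
by case: ifP.
Qed.

Lemma arrival_within_event i n h :
  driving_events X0 Z V B (Some (true, i, n)) (arrival_within i n h).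
Proof.
exists (if 0 < lambda i then `]-oo, h]%classic else set0).
  by case: ifP.
exact: arrival_withinE.
Qed.

Lemma prob_arrival_within i n h : 0 < h ->
  P (arrival_within i n h) = (1 - expR (- lambda i * h))%:E.
Proof.
move=> h0; have [li|li] := ltP 0 (lambda i).
  rewrite -(exponential_law_le (fun A => interarrival_law Hin (A := A) n li))//.
  by congr (P _); apply/seteqP; split=> w //= -[].
have -> : lambda i = 0 by apply/eqP; rewrite eq_le li Hlambda.
rewrite oppr0 mul0r expR0 subrr arrival_withinE ltNge li/=.
by rewrite preimage_set0 measure0.
Qed.

Lemma prob_arrival_within_le i n h : 0 < h ->
  (P (arrival_within i n h) <= (lambda i * h)%:E)%E.
Proof.
move=> h0; rewrite prob_arrival_within// lee_fin mulNr.
by case/andP: (expRN_bounds (mulr_ge0 (Hlambda i) (ltW h0))).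
Qed.

Lemma nonpositive_interarrivals : exists N, [/\ measurable N, P N = 0%E &
  forall w, ~ N w -> positive_interarrivals lambda V w].
Proof.
pose F i n := arrival_within i n 0.
have F0 i n : P (F i n) = 0%E.
  have [li|li] := ltP 0 (lambda i).
    rewrite -(exponential_law_le0 (fun A => interarrival_law Hin (A := A) n li)).
    by congr (P _); apply/seteqP; split=> w //= -[].
  by rewrite /F arrival_withinE ltNge li/= preimage_set0 measure0.
have mF i n : measurable (F i n) by exact: measurable_arrival_within.
exists (\bigcup_n \bigcup_(i in [set: 'I_D]) F i n); split.
- by apply: bigcupT_measurable => n; exact: fin_bigcup_measurable.
- apply/eqP; rewrite eq_le measure_ge0 andbT.
  have mbig n : measurable (\bigcup_(i in [set: 'I_D]) F i n).
    exact: fin_bigcup_measurable.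
  apply: le_trans (generalized_Boole_inequality _ mbig _) _.
    exact: bigcupT_measurable.
  rewrite eseries0// => n _ _; apply/eqP; rewrite eq_le measure_ge0 andbT.
  apply: le_trans (measure_fin_bigcup_le _ (fun i => mF i n)) _.
  by rewrite big1// => i _; exact: F0.
- move=> w nw i n li; rewrite ltNge; apply/negP => V0.
  by apply: nw; exists n => //; exists i.
Qed.

End queue_events.

(** * One small time step *)

Section one_step.
Context d (T : measurableType d) (dS : measure_display) (S : measurableType dS).
Variables (R : realType) (D : nat) (P : probability T R).
Variables (lambda c : 'I_D -> R) (Hc : forall i, 0 <= c i).
Variables (X0 : {mfun T >-> S}) (Z : R -> T -> 'I_D).
Variables (V B : 'I_D -> nat -> {RV P >-> R}) (b : nat -> {mfun S >-> R}).
Variables (phi : discipline R D S) (Hphi : service_discipline phi).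
Variables (r : R -> T -> customer D -> R).
Hypothesis Hr : queue_dynamics lambda c X0 Z V B b phi r.
Variables (W : R -> {RV P >-> R}) (HW : is_workload r W).
Variables (theta : R) (theta0 : 0 < theta).

Let cbar := \sum_i c i.
Let e t w := expR (- (theta * W t w)).

Definition some_arrival (h : R) : set T :=
  \bigcup_(i in [set: 'I_D]) arrival_within lambda V i 0%N h.

(** Pairs within one stream are enough: customers of two different streams can both enter only if
    the environment jumps, which is a case of an arrival together with a jump. *)
Definition two_arrivals (h : R) : set T :=
  \bigcup_(i in [set: 'I_D])
    (arrival_within lambda V i 0%N h `&` arrival_within lambda V i 1%N h).

(** A sum of the bounds met in the separate cases, so that it dominates each: a trivial bound on the
    increment, twice the largest change at rate [cbar], and the second-order remainder of the
    drift. *)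
Definition one_step_constant : R :=
  2 + 2 * (theta * cbar) + (theta * cbar) ^+ 2 * expR (theta * cbar).

(** The increment of [exp(- theta W) 1{Z = j}] over [0, h], minus its first-order
    expansion: the change of environment at frozen workload (contained in the
    first term), one arrival in state [j], and the drift [c j] while busy. *)
Definition one_step_increment (j : 'I_D) (h : R) (w : T) : R :=
  \1_[set w | Z h w = j] w * (e h w - e 0 w)
  + \1_([set w | Z 0 w = j] `&` arrival_within lambda V j 0%N h) w
    * (e 0 w * (1 - expR (- (theta * `|B j 0%N w|))))
  - \1_([set w | Z 0 w = j] `&` [set w | 0 < W 0 w]) w
    * (theta * h * c j * e 0 w).

Let indic01 (A : set T) w : 0 <= (\1_A w : R) <= 1.
Proof. by rewrite indicE; case: (_ \in _); rewrite !(lexx,ler01). Qed.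

Let indic1 (A : set T) w : A w -> \1_A w = 1 :> R.
Proof. by move=> Aw; rewrite indicE mem_set. Qed.

Let indic0 (A : set T) w : ~ A w -> \1_A w = 0 :> R.
Proof. by move=> Aw; rewrite indicE memNset. Qed.

(** Graded by probability: events of probability o(h) get a constant bound, events of probability
    o(1) a bound of order [h], and elsewhere the first-order terms cancel up to order [h ^+ 2]. *)
Lemma one_step_error j h w : positive_interarrivals lambda V w -> 0 < h <= 1 ->
  `|one_step_increment j h w| <= one_step_constant *
    (\1_(two_arrivals h) w
     + \1_(some_arrival h `&` environment_jump Z h) w
     + h * (\1_(some_arrival h) w + \1_(environment_jump Z h) w
            + \1_[set w | 0 < W 0 w <= cbar * h] w + h)).
Proof.
move=> Vw /andP[h0 h1]; have h0' := ltW h0.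
have cb0 : 0 <= cbar by apply: sumr_ge0.
have cj t : 0 <= c t <= cbar by rewrite Hc /=; exact: capacity_le_sum.
have y0 : 0 <= theta * cbar by rewrite mulr_ge0// ltW.
have yh : 0 <= theta * cbar * h <= theta * cbar.
  by rewrite mulr_ge0//= ler_piMr.
set M := one_step_constant.
have M2 : 2 + 2 * (theta * cbar) <= M.
  by rewrite /M /one_step_constant lerDl mulr_ge0 ?expR_ge0// sqr_ge0.
have M3 : (theta * cbar) ^+ 2 * expR (theta * cbar) <= M.
  by rewrite /M /one_step_constant lerDr addr_ge0// mulr_ge0.
have M0 : 0 <= M by lra.
have e01 t : 0 <= t -> 0 <= e t w <= 1.
  move=> t0; rewrite expR_ge0/= -expR0 ler_expR oppr_le0 mulr_ge0 ?(ltW theta0)//.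
  exact: (workload_ge0 Hr HW).
have /andP[eh0 eh1] := e01 h h0'; have /andP[e00 e0_1] := e01 0 (lexx _).
have W00 := workload_ge0 Hr HW w (lexx 0).
have Wh0 := workload_ge0 Hr HW w h0'.
have lip x y : 0 <= x -> 0 <= y ->
    `|expR (- (theta * x)) - expR (- (theta * y))| <= theta * `|x - y|.
  move=> x0 z0; apply: le_trans (expRN_lipschitz _ _) _;
    rewrite ?mulr_ge0 ?(ltW theta0)//.
  by rewrite -mulrBr normrM gtr0_norm.
have drift : 0 <= theta * h * c j * e 0 w <= theta * cbar * h.
  have /andP[c1 c2] := cj j.
  have th0 : 0 <= theta * h by rewrite mulr_ge0// ltW.
  have thc0 : 0 <= theta * h * c j by rewrite mulr_ge0.
  rewrite mulr_ge0//=; apply: (@le_trans _ _ (theta * h * c j)).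
    by rewrite ler_piMr.
  by rewrite mulrAC ler_wpM2r// ler_wpM2l// ltW.
have /andP[a0 a1] := indic01 (two_arrivals h) w.
have /andP[b0 b1] := indic01 (some_arrival h `&` environment_jump Z h) w.
have /andP[n0 n1] := indic01 (some_arrival h) w.
have /andP[j0 j1] := indic01 (environment_jump Z h) w.
have /andP[k0 k1] := indic01 [set w | 0 < W 0 w <= cbar * h] w.
set sum4 := (X in h * X); have sum40 : 0 <= h * sum4.
  by rewrite mulr_ge0// /sum4; lra.
(* For the o(1) events: an error of order [h] is absorbed as soon as one indicator in [sum4] equals
   1. *)
have small x : x <= 2 * (theta * cbar) * h -> 1 <= sum4 ->
    x <= M * (\1_(two_arrivals h) w
      + \1_(some_arrival h `&` environment_jump Z h) w + h * sum4).
  move=> xh s1; apply: le_trans xh _; apply: (@le_trans _ _ (M * h)).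
    by rewrite ler_wpM2r//; lra.
  rewrite ler_wpM2l//; apply: (@le_trans _ _ (h * sum4)); last lra.
  by rewrite ler_peMr.
(* For the o(h) events: the first two terms of the increment are at most 1 each and the drift is at
   most [theta * cbar]. *)
have crude : (1 : R) <= \1_(two_arrivals h) w
      + \1_(some_arrival h `&` environment_jump Z h) w ->
   `|one_step_increment j h w| <= M * (\1_(two_arrivals h) w
      + \1_(some_arrival h `&` environment_jump Z h) w + h * sum4).
  move=> ab1; apply: (@le_trans _ _ M); last by rewrite ler_peMr//; lra.
  apply: le_trans (ler_normB _ _) _.
  apply: le_trans (lerD (ler_normD _ _) (lexx _)) _.
  have prod1 (A : set T) (x : R) : `|\1_A w * x| <= `|x|.
    have /andP[i0 i1] := indic01 A w.
    by rewrite normrM (ger0_norm i0) ler_piMl.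
  have n1' : `|\1_[set w | Z h w = j] w * (e h w - e 0 w)| <= 1.
    by apply: le_trans (prod1 _ _) _; rewrite ler_norml; apply/andP; split; lra.
  have n2' : `|\1_([set w | Z 0 w = j] `&` arrival_within lambda V j 0%N h) w
      * (e 0 w * (1 - expR (- (theta * `|B j 0%N w|))))| <= 1.
    apply: le_trans (prod1 _ _) _.
    have tB : 0 <= theta * `|B j 0%N w| by rewrite mulr_ge0// ltW.
    have /andP[f0 _] := expRN_bounds tB.
    rewrite ger0_norm ?mulr_ge0//.
    rewrite -[leRHS]mulr1 ler_pM// gerBl expR_ge0//.
  have n3' : `|\1_([set w | Z 0 w = j] `&` [set w | 0 < W 0 w]) w
      * (theta * h * c j * e 0 w)| <= theta * cbar.
    apply: le_trans (prod1 _ _) _; rewrite ger0_norm; lra.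
  lra.
have [n2|nn2] := pselect (two_arrivals h w).
  by apply: crude; rewrite indic1//; lra.
have [nj|nnj] := pselect ((some_arrival h `&` environment_jump Z h) w).
  by apply: crude; rewrite (indic1 nj); lra.
clear crude.
have [Jw|nJ] := pselect (environment_jump Z h w).
  have nN : ~ some_arrival h w by move=> ?; apply: nnj.
  apply: small; last by rewrite /sum4 (indic1 Jw); lra.
  have noarr i : 0 < lambda i -> h < V i 0%N w.
    by move=> li; rewrite ltNge; apply/negP => Vh; apply: nN; exists i.
  rewrite /one_step_increment [X in _ + X * _ - _]indic0; last first.
    by case=> _ A; apply: nN; exists j.
  rewrite mul0r addr0.
  have Wle := workload_no_arrival_le Hc Hphi Hr HW Vw h0' noarr.
  have Wge := workload_ge Hc Hphi Hr HW Vw h0'.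
  have := lip _ _ Wh0 W00; rewrite -/(e h w) -/(e 0 w) => L.
  have L2 : `|W h w - W 0 w| <= cbar * h.
    by rewrite ler_norml; apply/andP; rewrite /cbar; split; lra.
  have {L L2} L : `|e h w - e 0 w| <= theta * cbar * h.
    by apply: le_trans L _; rewrite -mulrA ler_wpM2l// ltW.
  apply: le_trans (ler_normB _ _) _; rewrite !normrM.
  have /andP[i0 i1] := indic01 [set w | Z h w = j] w.
  have /andP[i0' i1'] := indic01 ([set w | Z 0 w = j] `&` [set w | 0 < W 0 w]) w.
  rewrite (ger0_norm i0) (ger0_norm i0') -!normrM.
  rewrite (ger0_norm (x := theta * h * c j * e 0 w)); last by case/andP: drift.
  have : \1_[set w | Z h w = j] w * `|e h w - e 0 w| <= `|e h w - e 0 w|.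
    by rewrite ler_piMl.
  have : \1_([set w | Z 0 w = j] `&` [set w | 0 < W 0 w]) w
      * (theta * h * c j * e 0 w) <= theta * h * c j * e 0 w.
    by rewrite ler_piMl//; case/andP: drift.
  by case/andP: drift => *; lra.
have Zc s : 0 <= s <= h -> Z s w = Z 0 w.
  by move=> sh; apply: contrapT => neq; apply: nJ; exists s.
have Zh : Z h w = Z 0 w by apply: Zc; rewrite h0' lexx.
have [Z0j|Z0j] := eqVneq (Z 0 w) j; last first.
  have nz : Z 0 w <> j by apply/eqP.
  have -> : one_step_increment j h w = 0.
    rewrite /one_step_increment [X in X * _ + _]indic0 ?mul0r; last by rewrite /= Zh.
    rewrite [X in _ + X * _ - _]indic0 ?mul0r ?add0r; last by case.
    by rewrite indic0 ?mul0r ?oppr0//; case.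
  by rewrite normr0 mulr_ge0//; lra.
have inc : one_step_increment j h w = e h w - e 0 w
    + \1_(arrival_within lambda V j 0%N h) w
      * (e 0 w * (1 - expR (- (theta * `|B j 0%N w|))))
    - \1_[set w | 0 < W 0 w] w * (theta * h * c j * e 0 w).
  rewrite /one_step_increment indic1/= ?Zh// mul1r; congr (_ + _ * _ - _ * _).
    by rewrite !indicE; congr ((_ : bool)%:R); apply/idP/idP; rewrite !inE; [case|split].
  by rewrite !indicE; congr ((_ : bool)%:R); apply/idP/idP; rewrite !inE; [case|split].
have [Nw|nN] := pselect (some_arrival h w).
  apply: small; last by rewrite /sum4 (indic1 Nw); lra.
  have no2 : ~ (0 < lambda (Z 0 w) /\ V (Z 0 w) 0%N w <= h /\ V (Z 0 w) 1%N w <= h).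
    by case=> l0 [v0 v1]; apply: nn2; exists (Z 0 w).
  have := workload_one_arrival Hc Hphi Hr HW Vw h0' Zc no2.
  rewrite Z0j /=; set Jmp := if _ then _ else _; case=> J0 Wge Wle.
  (* Comparison with the workload [W 0 w + Jmp], where the requirement is added but no service
     given: its exponential cancels the arrival term exactly, also when [Jmp = 0] because the
     arrival belongs to another stream. Ignoring service costs order [h]. *)
  have -> : one_step_increment j h w =
      (e h w - expR (- (theta * (W 0 w + Jmp))))
      - \1_[set w | 0 < W 0 w] w * (theta * h * c j * e 0 w).
    have -> : expR (- (theta * (W 0 w + Jmp))) = e 0 w * expR (- (theta * Jmp)).
      by rewrite /e -expRD; congr expR; ring.
    rewrite inc; congr (_ - _); rewrite /Jmp indicE.
    have [lj|lj] := ltP 0 (lambda j); last first.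
      by rewrite memNset/= ?mulr0 ?oppr0 ?expR0; [ring|case; rewrite ltNge lj].
    have [vj|vj] := leP (V j 0%N w) h; last first.
      by rewrite memNset/= ?mulr0 ?oppr0 ?expR0; [ring|case; rewrite leNgt vj].
    rewrite mem_set//= ger0_norm; first by ring.
    by move: J0; rewrite /Jmp lj vj.
  have WJ0 : 0 <= W 0 w + Jmp by rewrite addr_ge0.
  have L := lip _ _ Wh0 WJ0.
  have L2 : `|W h w - (W 0 w + Jmp)| <= cbar * h.
    by rewrite ler_norml; apply/andP; rewrite /cbar; split; lra.
  have {L L2} L : `|e h w - expR (- (theta * (W 0 w + Jmp)))| <= theta * cbar * h.
    by apply: le_trans L _; rewrite -mulrA ler_wpM2l// ltW.
  apply: le_trans (ler_normB _ _) _.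
  have /andP[i0' i1'] := indic01 [set w | 0 < W 0 w] w.
  have /andP[dr0 dr1] := drift.
  rewrite (ger0_norm (mulr_ge0 i0' dr0)).
  have : \1_[set w | 0 < W 0 w] w
      * (theta * h * c j * e 0 w) <= theta * h * c j * e 0 w by rewrite ler_piMl.
  lra.
have noarr i : 0 < lambda i -> h < V i 0%N w.
  by move=> li; rewrite ltNge; apply/negP => Vh; apply: nN; exists i.
have {}inc : one_step_increment j h w = e h w - e 0 w
    - \1_[set w | 0 < W 0 w] w * (theta * h * c j * e 0 w).
  by rewrite inc indic0 ?mul0r ?addr0// => A; apply: nN; exists j.
have Wle := workload_no_arrival_le Hc Hphi Hr HW Vw h0' noarr.
have Wge := workload_ge Hc Hphi Hr HW Vw h0'.
(* Without arrivals an empty queue stays empty, and a workload above [cbar * h] drifts without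
   hitting 0. In between the server may become idle before [h]; that range is covered by its own
   indicator. *)
have [W0p|W0n] := ltP 0 (W 0 w); last first.
  have W0E : W 0 w = 0 by lra.
  have WhE : W h w = 0 by lra.
  rewrite inc indic0/= ?W0E ?ltxx// mul0r subr0 /e W0E WhE subrr normr0.
  by rewrite mulr_ge0//; lra.
rewrite inc indic1// mul1r.
have [WK|WK] := leP (W 0 w) (cbar * h).
  apply: small; last by rewrite /sum4 (@indic1 [set w | 0 < W 0 w <= cbar * h])/= ?W0p//; lra.
  have L := lip _ _ Wh0 W00.
  have L2 : `|W h w - W 0 w| <= cbar * h.
    by rewrite ler_norml; apply/andP; rewrite /cbar; split; lra.
  have {L L2} L : `|e h w - e 0 w| <= theta * cbar * h.
    by apply: le_trans L _; rewrite -mulrA ler_wpM2l// ltW.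
  have /andP[dr0 dr1] := drift.
  apply: le_trans (ler_normB _ _) _; rewrite (ger0_norm dr0); lra.
have WE := workload_drift Hc Hphi Hr HW Vw h0' noarr Zc WK.
set x := theta * c j * h.
have /andP[c1 c2] := cj j.
have x0 : 0 <= x by rewrite /x !mulr_ge0// ltW.
have xh : x <= theta * cbar * h by rewrite /x ler_wpM2r// ler_wpM2l// ltW.
have /andP[E0 E1] := expR_taylor1 x0.
have -> : e h w - e 0 w - theta * h * c j * e 0 w = e 0 w * (expR x - 1 - x).
  rewrite /e WE Z0j.
  have -> : - (theta * (W 0 w - c j * h)) = - (theta * W 0 w) + x.
    by rewrite /x; ring.
  by rewrite expRD /x; ring.
rewrite normrM (ger0_norm e00) (ger0_norm E0).
apply: (@le_trans _ _ (expR x - 1 - x)); first by rewrite ler_piMl.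
apply: le_trans E1 _; apply: (@le_trans _ _ (M * (h * h))); last first.
  rewrite ler_wpM2l//; have : h * h <= h * sum4 by rewrite ler_wpM2l// /sum4; lra.
  lra.
apply: (@le_trans _ _ ((theta * cbar) ^+ 2 * expR (theta * cbar) * (h * h))); last first.
  by rewrite ler_wpM2r// mulr_ge0.
have -> : (theta * cbar) ^+ 2 * expR (theta * cbar) * (h * h)
  = (theta * cbar * h) ^+ 2 * expR (theta * cbar) by ring.
rewrite ler_pM ?sqr_ge0 ?expR_ge0//.
  by rewrite ler_sqr ?nnegrE//; case/andP: yh.
by rewrite ler_expR; case/andP: yh => *; lra.
Qed.

End one_step.

(** * The transform equation *)

Lemma cvgr_sum (R : realType) (I : Type) (s : seq I) (F : I -> nat -> R)
    (l : I -> R) : (forall i, F i n @[n --> \oo] --> l i) ->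
  \sum_(i <- s) F i n @[n --> \oo] --> \sum_(i <- s) l i.
Proof.
move=> Fl; elim: s => [|i s IH].
  by under eq_fun do rewrite big_nil; rewrite big_nil; exact: cvg_cst.
by under eq_fun do rewrite big_cons; rewrite big_cons; exact: cvgD.
Qed.

Section bounded_measurable.
Context d (T : measurableType d) (R : realType) (P : probability T R).
Implicit Types f g : T -> R.

(** A class closed under the operations used on transforms and integrable over every measurable
    event, which settles the side conditions of linearity at once. *)
Definition bounded_measurable f :=
  measurable_fun setT f /\ exists M, forall w, `|f w| <= M.

Lemma bounded_measurableD f g : bounded_measurable f -> bounded_measurable g ->
  bounded_measurable (fun w => f w + g w).
Proof.
move=> [mf [M fM]] [mg [N gN]]; split; first exact: measurable_funD.
by exists (M + N) => w; apply: le_trans (ler_normD _ _) _; exact: lerD.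
Qed.

Lemma bounded_measurableM f g : bounded_measurable f -> bounded_measurable g ->
  bounded_measurable (fun w => f w * g w).
Proof.
move=> [mf [M fM]] [mg [N gN]]; split; first exact: measurable_funM.
by exists (M * N) => w; rewrite normrM ler_pM.
Qed.

Lemma bounded_measurable_cst (x : R) : bounded_measurable (fun=> x).
Proof. by split; [exact: measurable_cst|exists `|x|]. Qed.

Lemma bounded_measurable_indic (A : set T) :
  measurable A -> bounded_measurable \1_A.
Proof.
move=> mA; split; first exact: measurable_indic.
by exists 1 => w; rewrite indicE; case: (_ \in _); rewrite ?normr1 ?normr0.
Qed.

Lemma bounded_measurableB f g : bounded_measurable f -> bounded_measurable g ->
  bounded_measurable (fun w => f w - g w).
Proof.
move=> mf mg.
have -> : (fun w => f w - g w) = (fun w => f w + (-1) * g w).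
  by apply/funext => w; rewrite mulN1r.
apply: bounded_measurableD => //.
by apply: bounded_measurableM => //; exact: bounded_measurable_cst.
Qed.

Lemma bounded_measurable_expRN f : measurable_fun setT f ->
  (forall w, 0 <= f w) -> bounded_measurable (fun w => expR (- f w)).
Proof.
move=> mf f0; split.
  apply: measurableT_comp; first exact: measurable_expR.
  by apply: measurableT_comp mf; exact: oppr_measurable.
exists 1 => w; rewrite ger0_norm ?expR_ge0// -expR0 ler_expR oppr_le0.
exact: f0.
Qed.

Lemma bounded_measurable_integrable f (A : set T) : measurable A ->
  bounded_measurable f -> P.-integrable A (EFin \o f).
Proof.
move=> mA [mf [M fM]]; apply: measurable_bounded_integrable => //.
- by rewrite ltey_eq fin_num_measure.
- exact: measurable_funTS.
- by exists M; split; rewrite ?num_real// => x Mx y _; exact: le_trans (fM y) (ltW Mx).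
Qed.

Lemma Rintegral_indic_mul f (A : set T) :
  \int[P]_w (\1_A w * f w) = \int[P]_(w in A) f w.
Proof.
rewrite [RHS]Rintegral_mkcond; apply: eq_Rintegral => w _.
by rewrite patchE indicE; case: ifP => _; rewrite ?mul1r ?mul0r.
Qed.

Lemma Rintegral_indic (A : set T) : measurable A ->
  \int[P]_w (\1_A w) = fine (P A).
Proof. by move=> mA; rewrite /Rintegral integral_indic// setIT. Qed.

Lemma bounded_RintegralD f g : bounded_measurable f -> bounded_measurable g ->
  \int[P]_w (f w + g w) = \int[P]_w f w + \int[P]_w g w.
Proof. by move=> mf mg; apply: RintegralD => //; exact: bounded_measurable_integrable. Qed.

Lemma bounded_RintegralB f g : bounded_measurable f -> bounded_measurable g ->
  \int[P]_w (f w - g w) = \int[P]_w f w - \int[P]_w g w.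
Proof. by move=> mf mg; apply: RintegralB => //; exact: bounded_measurable_integrable. Qed.

Lemma bounded_RintegralZ (x : R) f (A : set T) : measurable A ->
  bounded_measurable f ->
  \int[P]_(w in A) (x * f w) = x * \int[P]_(w in A) f w.
Proof. by move=> mA mf; apply: RintegralZl => //; exact: bounded_measurable_integrable. Qed.

Lemma bounded_Rintegral_sum (I : Type) (s : seq I) (F : I -> T -> R) :
  (forall i, bounded_measurable (F i)) ->
  bounded_measurable (fun w => \sum_(i <- s) F i w) /\
  \int[P]_w (\sum_(i <- s) F i w) = \sum_(i <- s) \int[P]_w F i w.
Proof.
move=> bF; elim: s => [|i s [bs IH]].
  under [X in bounded_measurable X]eq_fun do rewrite big_nil.
  under eq_Rintegral do rewrite big_nil.
  by rewrite big_nil Rintegral_cst// mul0r; split=> //; exact: bounded_measurable_cst.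
under [X in bounded_measurable X]eq_fun do rewrite big_cons.
under eq_Rintegral do rewrite big_cons.
by rewrite big_cons bounded_RintegralD// IH; split=> //; exact: bounded_measurableD.
Qed.

Lemma le_norm_Rintegral_outside f g (N : set T) :
  bounded_measurable f -> bounded_measurable g -> (forall w, 0 <= g w) ->
  measurable N -> P N = 0%E -> (forall w, ~ N w -> `|f w| <= g w) ->
  `|\int[P]_w f w| <= \int[P]_w g w.
Proof.
move=> bf bg g0 mN PN fg.
apply: le_trans (le_normr_Rintegral _ _) _ => //.
  exact: bounded_measurable_integrable.
have mf : measurable_fun setT f by case: bf.
have bnf : bounded_measurable (fun w => `|f w|).
  split; first by apply: measurableT_comp mf; exact: normr_measurable.
  by case: bf => _ [M fM]; exists M => w; rewrite normr_id.
have fin h : bounded_measurable h -> (\int[P]_w (h w)%:E)%E \is a fin_num.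
  by move=> bh; apply: integrable_fin_num => //; exact: bounded_measurable_integrable.
rewrite /Rintegral fine_le ?fin//.
apply: ae_ge0_le_integral => //.
- by apply/measurable_EFinP; case: bnf.
- by move=> w _; rewrite lee_fin.
- by apply/measurable_EFinP; case: bg.
- exists N; split=> // w /= h; apply: contrapT => nN; apply: h => _.
  by rewrite lee_fin fg.
Qed.

End bounded_measurable.

Section transform_equation.
Context d (T : measurableType d) (dS : measure_display) (S : measurableType dS).
Variables (R : realType) (D : nat) (P : probability T R) (Q : 'M[R]_D).
Variables (lambda c : 'I_D -> R) (H : 'I_D -> probability (measurableTypeR R) R).
Hypothesis Hlambda : forall i, 0 <= lambda i.
Hypothesis Hc : forall i, 0 <= c i.
Variables (X0 : {mfun T >-> S}) (Z : R -> T -> 'I_D).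
Hypothesis HZ : markov_environment P Q X0 Z.
Variables (V B : 'I_D -> nat -> {RV P >-> R}).
Hypothesis Hin : modulated_input lambda H X0 Z V B.
Variables (b : nat -> {mfun S >-> R}).
Variables (phi : discipline R D S) (Hphi : service_discipline phi).
Variables (r : R -> T -> customer D -> R).
Hypothesis Hr : queue_dynamics lambda c X0 Z V B b phi r.
Variables (W : R -> {RV P >-> R}).
Hypothesis HW : is_workload r W.
Hypothesis Hst : steady_state Z W.

Definition workload_transform (theta : R) (j : 'I_D) : R :=
  \int[P]_(w in [set w | Z 0 w = j]) expR (- (theta * W 0 w)).

(** The absolute value keeps the integrand bounded on the whole line; in the theorem [H j] gives no
    mass to negative numbers. *)
Definition requirement_transform (theta : R) (j : 'I_D) : R :=
  \int[H j]_x expR (- (theta * `|x|)).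

Definition idle_probability (j : 'I_D) : R :=
  fine (P [set w | W 0 w = 0 /\ Z 0 w = j]).

Lemma measurable_state t i : 0 <= t -> measurable [set w | Z t w = i].
Proof. by move=> t0; exact: (environment_measurable HZ). Qed.

(** [b] takes negative values only off the range of [X0], where the total is
    irrelevant; absolute values make the series measurable everywhere. *)
Let initial_work (x : S) : R := fine (\sum_(0 <= n <oo) `|b n x|%:E)%E.

Let measurable_initial_work : measurable_fun setT initial_work.
Proof.
apply: measurableT_comp; first exact: fine_measurable.
apply: ge0_emeasurable_sum => [n x _ _|n _]; first by rewrite lee_fin.
apply/measurable_EFinP; apply: measurableT_comp; first exact: normr_measurable.
exact: measurable_funPT.
Qed.

Let initial_workP : exists N, [/\ measurable N, P N = 0%E &
  forall w, ~ N w -> positive_interarrivals lambda V w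
                     /\ W 0 w = initial_work (X0 w)].
Proof.
have [N [mN PN pos]] := nonpositive_interarrivals Hin.
exists N; split=> // w /pos Vw; split=> //.
have [W0E _ _] := workload_balance0 Hc Hphi Hr HW Vw (lexx 0).
have b0 n : 0 <= b n (X0 w).
  exact: ((workload_balance Hc Hphi Hr HW w (lexx 0)).1 (None, n)).
rewrite /initial_work -[LHS]/(fine (W 0 w)%:E) W0E; congr fine.
by apply: eq_eseriesr => n _; rewrite ger0_norm.
Qed.

(** Up to a null set, an event of the initial workload is determined by [X0], so
    that the Markov property and independence apply to it. *)
Lemma initial_workload_event A : measurable A -> exists A',
  measurable A' /\ forall E, measurable E ->
  P (W 0 @^-1` A `&` E) = P (X0 @^-1` A' `&` E).
Proof.
move=> mA; have [N [mN PN W0E]] := initial_workP.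
exists (initial_work @^-1` A); split=> [|E mE].
  by rewrite -[X in measurable X]setTI; exact: measurable_initial_work.
apply: measure_eq_outside mN PN _ _ _.
- by apply: measurableI => //; exact: (measurable_funPTI (W 0)).
- apply: measurableI => //; apply: (measurable_funPTI X0).
  by rewrite -[X in measurable X]setTI; exact: measurable_initial_work.
- by move=> w /W0E[_ W0wE]; rewrite /= W0wE.
Qed.

Section fixed_theta.
Variables (theta : R) (theta0 : 0 < theta).

Let e t w := expR (- (theta * W t w)).
Let f (x : R) := expR (- (theta * x)).

Let mf : measurable_fun setT f.
Proof.
apply: measurableT_comp; first exact: measurable_expR.
apply: measurableT_comp; first exact: oppr_measurable.
exact: mulrl_measurable.
Qed.

Let f_ge0 x : 0 <= f x. Proof. exact: expR_ge0. Qed.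

Let bounded_e t : 0 <= t -> bounded_measurable (e t).
Proof.
move=> t0; apply: bounded_measurable_expRN => [|w].
  by apply: measurable_funM; [exact: measurable_cst|exact: measurable_funPT].
by rewrite mulr_ge0 ?(ltW theta0)//; exact: (workload_ge0 Hr HW).
Qed.

Let integral_e_fin t A : 0 <= t -> measurable A ->
  (\int[P]_(w in A) (e t w)%:E)%E \is a fin_num.
Proof.
move=> t0 mA; apply: integrable_fin_num => //.
by apply: bounded_measurable_integrable => //; exact: bounded_e.
Qed.

Let zero0 : (0 : R) <= 0 := lexx 0.

Lemma stationary_transform h j : 0 <= h ->
  \int[P]_(w in [set w | Z h w = j]) e h w = workload_transform theta j.
Proof.
move=> h0; rewrite /workload_transform /Rintegral.
rewrite (@integral_eq_scale _ _ _ _ (W h) (W 0) _ [set w | Z 0 w = j] 1 f)//.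
- by rewrite mul1e.
- exact: measurable_state.
- exact: measurable_state.
- by move=> A mA; rewrite mul1e; exact: Hst.
Qed.

(** The Markov property is applied at time 0 to events of [X0], which stand for the events of [W 0];
    the integral is then decomposed according to the initial state. *)
Lemma markov_transform p h j : 0 <= h ->
  (forall s t E i j, 0 <= s -> 0 <= t -> environment_events X0 Z `[0, s] E ->
      P (E `&` [set w | Z s w = i] `&` [set w | Z (s + t) w = j]) =
      (P (E `&` [set w | Z s w = i]) * (p t i j)%:E)%E) ->
  (forall i j, 0 <= p h i j) ->
  \int[P]_(w in [set w | Z h w = j]) e 0 w
    = \sum_i workload_transform theta i * p h i j.
Proof.
move=> h0 markov p0.
have ms t i : 0 <= t -> measurable [set w | Z t w = i] by exact: measurable_state.
have E i : (\int[P]_(w in [set w | Z 0%R w = i] `&` [set w | Z h w = j]) (e 0%R w)%:E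
    = (p h i j)%:E * \int[P]_(w in [set w | Z 0%R w = i]) (e 0%R w)%:E)%E.
  apply: (@integral_eq_scale _ _ _ _ (W 0) (W 0) _ _ _ f) => //.
  - by apply: measurableI; exact: ms.
  - exact: ms.
  - move=> A /initial_workload_event[A' [mA' WX]].
    rewrite !WX; [|exact: ms|by apply: measurableI; exact: ms].
    rewrite muleC setIA.
    have := markov 0 h (X0 @^-1` A') i j zero0 h0.
    by rewrite add0r; apply; exact: environment_event_initial.
rewrite -Rintegral_indic_mul.
transitivity (\int[P]_w (\sum_i
    (\1_([set w | Z 0 w = i] `&` [set w | Z h w = j]) w * e 0 w))).
  apply: eq_Rintegral => w _; rewrite -mulr_suml; congr (_ * _).
  rewrite (bigD1 (Z 0 w))//= big1 ?addr0; last first.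
    move=> i ni; rewrite indicE memNset//= => -[Zi _].
    by rewrite Zi eqxx in ni.
  by rewrite !indicE; congr ((_ : bool)%:R); apply/idP/idP; rewrite !inE; [split|case].
have bi i : bounded_measurable (fun w =>
    \1_([set w | Z 0 w = i] `&` [set w | Z h w = j]) w * e 0 w).
  apply: bounded_measurableM; last exact: bounded_e.
  by apply: bounded_measurable_indic; apply: measurableI; exact: ms.
rewrite (bounded_Rintegral_sum _ _ bi).2; apply: eq_bigr => i _.
rewrite Rintegral_indic_mul /Rintegral E fineM//; first by rewrite mulrC.
by apply: integral_e_fin => //; exact: ms.
Qed.

(** On the idle event the exponential equals 1, so the part removed from the transform is a
    probability. *)
Lemma idle_transform j :
  \int[P]_(w in [set w | Z 0 w = j] `&` [set w | 0 < W 0 w]) e 0 w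
    = workload_transform theta j - idle_probability j.
Proof.
have mp : measurable [set w | 0 < W 0 w].
  have -> : [set w | 0 < W 0 w] = W 0 @^-1` `]0, +oo[.
    by apply/seteqP; split=> w /=; rewrite in_itv/= andbT.
  exact: (measurable_funPTI (W 0)).
have m0 : measurable [set w | W 0 w = 0].
  by apply: (measurable_funPTI (W 0) (Y := [set 0])).
have ms : measurable [set w | Z 0 w = j] by exact: measurable_state.
apply/eqP; rewrite eq_sym subr_eq; apply/eqP.
rewrite /workload_transform -[LHS]Rintegral_indic_mul.
rewrite -[X in X + _]Rintegral_indic_mul.
have -> : idle_probability j
    = \int[P]_w (\1_([set w | W 0 w = 0] `&` [set w | Z 0 w = j]) w).
  by rewrite Rintegral_indic//; exact: measurableI.
rewrite -bounded_RintegralD; last 2 first.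
- apply: bounded_measurableM; last exact: bounded_e.
  by apply: bounded_measurable_indic; exact: measurableI.
- by apply: bounded_measurable_indic; exact: measurableI.
apply: eq_Rintegral => w _; rewrite !indicE.
have W0 := workload_ge0 Hr HW w zero0.
have [Zj|Zj] := pselect (Z 0 w = j); last first.
  by rewrite !memNset ?mul0r ?addr0//=; tauto.
rewrite mem_set//.
have [Wp|Wn] := ltP 0 (W 0 w).
  rewrite mem_set// memNset ?addr0//= => -[W0E _].
  by rewrite W0E ltxx in Wp.
have W0E : W 0 w = 0 by apply/eqP; rewrite eq_le Wn W0.
rewrite memNset/= ?W0E ?ltxx; last by case.
by rewrite mem_set//= /e W0E mulr0 oppr0 expR0 mul0r add0r mul1r.
Qed.

Lemma requirement_transformE j n : (\int[P]_w (1 - f `|B j n w|)%:E)%E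
  = (1 - requirement_transform theta j)%:E.
Proof.
pose g (x : R) := 1 - f `|x|.
have g0 x : 0 <= g x.
  rewrite subr_ge0 -expR0 ler_expR oppr_le0 mulr_ge0//; exact: ltW.
have mfn : measurable_fun setT (fun x : R => f `|x|).
  by apply: measurableT_comp; [exact: mf|exact: normr_measurable].
have bfn : bounded_measurable (fun x : measurableTypeR R => f `|x|).
  apply: bounded_measurable_expRN => [|x]; last by rewrite mulr_ge0// ltW.
  by apply: measurable_funM; [exact: measurable_cst|exact: normr_measurable].
have mg : measurable_fun setT g by apply: measurable_funB => //; exact: measurable_cst.
have mB : measurable_fun setT (B j n : T -> measurableTypeR R).
  by move=> _ Y mY; exact: (measurable_funPT (B j n)).
have mEg : measurable_fun setT (fun x : measurableTypeR R => (g x)%:E).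
  exact/measurable_EFinP.
transitivity (\int[H j]_x (g x)%:E)%E.
  transitivity (\int[pushforward P (B j n : T -> measurableTypeR R)]_x (g x)%:E)%E.
    by rewrite ge0_integral_pushforward// => x _; rewrite lee_fin.
  by apply: eq_measure_integral => A mA _; exact: (requirement_law Hin).
have fin : (\int[H j]_x (g x)%:E)%E \is a fin_num.
  apply: integrable_fin_num => //; apply: bounded_measurable_integrable => //.
  by apply: bounded_measurableB => //; exact: bounded_measurable_cst.
rewrite -[LHS]fineK//; congr EFin.
rewrite -[LHS]/(\int[H j]_x (1 - f `|x|)) bounded_RintegralB//; last first.
  exact: bounded_measurable_cst.
congr (_ - _); rewrite Rintegral_cst//.
by have /= -> := probability_setT (H j); rewrite mulr1.
Qed.

(** The initial data with [Z 0], the first interarrival time and the first requirement of stream [j]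
    belong to three distinct members of the independent family. *)
Lemma arrival_transform h j : 0 < h ->
  \int[P]_(w in [set w | Z 0 w = j] `&` arrival_within lambda V j 0%N h)
     (e 0 w * (1 - expR (- (theta * `|B j 0%N w|))))
  = (1 - expR (- lambda j * h)) * workload_transform theta j
    * (1 - requirement_transform theta j).
Proof.
move=> h0.
have ms : measurable [set w | Z 0 w = j] by exact: measurable_state.
have ma := measurable_arrival_within lambda V j 0 h.
have k0 : 0 <= 1 - expR (- lambda j * h).
  have := prob_arrival_within Hlambda Hin j 0 h0.
  by move=> /(congr1 (fun x => 0 <= x)%E); rewrite measure_ge0 lee_fin => <-.
rewrite /Rintegral (@integral_indep_prod _ _ _ _ (W 0) (B j 0%N) _
  [set w | Z 0 w = j] (1 - expR (- lambda j * h)) f (fun x => 1 - f `|x|))//.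
- rewrite requirement_transformE fineM//; last first.
    by rewrite fin_numM// integral_e_fin.
  by rewrite fineM// integral_e_fin.
- exact: measurableI.
- move=> A C /initial_workload_event[A' [mA' WX]] mC.
  have mBC : measurable (B j 0%N @^-1` C) by exact: (measurable_funPTI (B j 0%N)).
  rewrite WX// -setIA WX; last by apply: measurableI => //; exact: measurableI.
  pose E := X0 @^-1` A' `&` [set w | Z 0 w = j].
  have -> : X0 @^-1` A' `&` (B j 0%N @^-1` C `&` ([set w | Z 0 w = j]
      `&` arrival_within lambda V j 0%N h))
      = E `&` arrival_within lambda V j 0%N h `&` B j 0%N @^-1` C.
    by apply/seteqP; split=> w; rewrite /E /=; tauto.
  rewrite (@mutually_independent3 _ _ _ _ _ _ None (Some (true, j, 0%N))
    (Some (false, j, 0%N)) _ _ _ (input_independent Hin))//.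
  + rewrite -/E (prob_arrival_within Hlambda Hin)//.
    by rewrite [in RHS](muleC (_ - _)%:E).
  + apply: environment_eventI; first exact: environment_event_initial.
    by apply: environment_event_state; rewrite /= in_itv/= lexx.
  + exact: arrival_within_event.
  + by exists C.
- by apply: measurable_funB; [exact: measurable_cst|
    apply: measurableT_comp; [exact: mf|exact: normr_measurable]].
- by move=> x; rewrite subr_ge0 -expR0 ler_expR oppr_le0 mulr_ge0// ltW.
Qed.

Let psi := workload_transform theta.
Let beta := requirement_transform theta.

Let bounded_indicM (A : set T) (g : T -> R) : measurable A -> bounded_measurable g ->
  bounded_measurable (fun w => \1_A w * g w).
Proof.
by move=> mA bg; apply: bounded_measurableM => //; exact: bounded_measurable_indic.
Qed.

Let measurable_some_arrival h : measurable (some_arrival lambda V h).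
Proof.
by apply: fin_bigcup_measurable => // i _; exact: measurable_arrival_within.
Qed.

Let measurable_two_arrivals h : measurable (two_arrivals lambda V h).
Proof.
by apply: fin_bigcup_measurable => // i _; apply: measurableI;
  exact: measurable_arrival_within.
Qed.

Let cbar := \sum_i c i.
Let low h := [set w | 0 < W 0 w <= cbar * h].

Let measurable_low h : measurable (low h).
Proof.
have -> : low h = W 0 @^-1` `]0, (cbar * h)].
  by apply/seteqP; split=> w /=; rewrite in_itv.
exact: (measurable_funPTI (W 0)).
Qed.

Let fineP (A : set T) : measurable A -> (fine (P A))%:E = P A.
Proof. by move=> mA; rewrite fineK// fin_num_measure. Qed.

Let l1 := \sum_i lambda i.
Let l2 := \sum_i lambda i ^+ 2.

Let prob_some_arrival h : 0 < h -> fine (P (some_arrival lambda V h)) <= l1 * h.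
Proof.
move=> h0; rewrite -lee_fin fineP//.
apply: le_trans (measure_fin_bigcup_le _ _) _ => [i|].
  exact: measurable_arrival_within.
rewrite /l1 mulr_suml -sumEFin; apply: lee_sum => i _.
exact: (prob_arrival_within_le Hlambda Hin).
Qed.

Let prob_two_arrivals h : 0 < h ->
  fine (P (two_arrivals lambda V h)) <= l2 * h ^+ 2.
Proof.
move=> h0; rewrite -lee_fin fineP//.
apply: le_trans (measure_fin_bigcup_le _ _) _ => [i|].
  by apply: measurableI; exact: measurable_arrival_within.
rewrite /l2 mulr_suml -sumEFin; apply: lee_sum => i _.
rewrite (@mutually_independent2 _ _ _ _ _ _ (Some (true, i, 0%N))
  (Some (true, i, 1%N)) _ _ (input_independent Hin))//; last 3 first.
- by apply/eqP => -[].
- exact: arrival_within_event.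
- exact: arrival_within_event.
rewrite -exprMn expr2 EFinM; apply: lee_pmul => //;
  exact: (prob_arrival_within_le Hlambda Hin).
Qed.

Let prob_arrival_jump h : 0 < h ->
  fine (P (some_arrival lambda V h `&` environment_jump Z h))
    <= l1 * h * fine (P (environment_jump Z h)).
Proof.
move=> h0; have mJ := measurable_environment_jump HZ (ltW h0).
rewrite -lee_fin fineP; last exact: measurableI.
have mA i : measurable (arrival_within lambda V i 0%N h `&` environment_jump Z h).
  by apply: measurableI => //; exact: measurable_arrival_within.
rewrite /some_arrival setI_bigcupl.
apply: le_trans (measure_fin_bigcup_le _ mA) _.
rewrite /l1 !mulr_suml -sumEFin; apply: lee_sum => i _.
rewrite (@mutually_independent2 _ _ _ _ _ _ (Some (true, i, 0%N))
  None _ _ (input_independent Hin))//; last 2 first.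
- exact: arrival_within_event.
- exact: (environment_jump_event HZ (ltW h0)).
rewrite EFinM fineP//; apply: lee_pmul => //.
exact: (prob_arrival_within_le Hlambda Hin).
Qed.

Let M := one_step_constant c theta.

Let M_ge0 : 0 <= M.
Proof.
have cb0 : 0 <= theta * \sum_i c i by rewrite mulr_ge0 ?(ltW theta0)// sumr_ge0.
rewrite /M /one_step_constant addr_ge0//; first by rewrite addr_ge0// mulr_ge0.
by apply: mulr_ge0; [exact: sqr_ge0|exact: expR_ge0].
Qed.

(** What the probability bounds for arrivals and jumps give in [one_step_error] once a factor [h] is
    taken out; each term tends to 0. *)
Let one_step_rate h := M * (h * (l2 + l1 + 1)
  + (l1 + 1) * fine (P (environment_jump Z h)) + fine (P (low h))).

Let transform_step p h j : 0 < h <= 1 ->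
  (forall s t E i j, 0 <= s -> 0 <= t -> environment_events X0 Z `[0, s] E ->
      P (E `&` [set w | Z s w = i] `&` [set w | Z (s + t) w = j]) =
      (P (E `&` [set w | Z s w = i]) * (p t i j)%:E)%E) ->
  (forall i j, 0 <= p h i j) ->
  `|psi j - \sum_i psi i * p h i j
    + (1 - expR (- lambda j * h)) * psi j * (1 - beta j)
    - theta * h * c j * (psi j - idle_probability j)| <= h * one_step_rate h.
Proof.
move=> /[dup] h01 /andP[h0 h1] markov p0; have h0' := ltW h0.
have ms t i : 0 <= t -> measurable [set w | Z t w = i] by exact: measurable_state.
have mJ := measurable_environment_jump HZ h0'.
have mpos : measurable [set w | 0 < W 0 w].
  have -> : [set w | 0 < W 0 w] = W 0 @^-1` `]0, +oo[.
    by apply/seteqP; split=> w /=; rewrite in_itv/= andbT.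
  exact: (measurable_funPTI (W 0)).
have be t : 0 <= t -> bounded_measurable (e t) by exact: bounded_e.
have bB : bounded_measurable (fun w => e 0 w * (1 - expR (- (theta * `|B j 0%N w|)))).
  apply: bounded_measurableM; first exact: be.
  apply: bounded_measurableB; first exact: bounded_measurable_cst.
  apply: bounded_measurable_expRN => [|w]; last by rewrite mulr_ge0// ltW.
  apply: measurable_funM; first exact: measurable_cst.
  by apply: measurableT_comp; [exact: normr_measurable|exact: measurable_funPT].
have b1 : bounded_measurable (fun w => \1_[set w | Z h w = j] w * (e h w - e 0 w)).
  by apply: bounded_indicM; [exact: ms|apply: bounded_measurableB; exact: be].
have b2 : bounded_measurable (fun w =>
    \1_([set w | Z 0 w = j] `&` arrival_within lambda V j 0%N h) w
      * (e 0 w * (1 - expR (- (theta * `|B j 0%N w|))))).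
  apply: bounded_indicM => //; apply: measurableI; first exact: ms.
  exact: measurable_arrival_within.
have b3 : bounded_measurable (fun w =>
    \1_([set w | Z 0 w = j] `&` [set w | 0 < W 0 w]) w
    * (theta * h * c j * e 0 w)).
  apply: bounded_indicM; first by apply: measurableI => //; exact: ms.
  by apply: bounded_measurableM; [exact: bounded_measurable_cst|exact: be].
have E : \int[P]_w one_step_increment lambda c Z V B W theta j h w =
    psi j - \sum_i psi i * p h i j
    + (1 - expR (- lambda j * h)) * psi j * (1 - beta j)
    - theta * h * c j * (psi j - idle_probability j).
  rewrite /one_step_increment bounded_RintegralB//; last exact: bounded_measurableD.
  rewrite bounded_RintegralD// !Rintegral_indic_mul arrival_transform//.
  rewrite bounded_RintegralZ ?idle_transform//; last 2 first.
  - by apply: measurableI => //; exact: ms.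
  - exact: be.
  congr (_ + _ - _).
  rewrite RintegralB//; last 3 first.
  - exact: ms.
  - by apply: bounded_measurable_integrable; [exact: ms|exact: be].
  - by apply: bounded_measurable_integrable; [exact: ms|exact: be].
  by rewrite stationary_transform// (markov_transform j h0' markov p0).
have [N [mN PN pos]] := nonpositive_interarrivals Hin.
pose i1 w : R := \1_(two_arrivals lambda V h) w.
pose i2 w : R := \1_(some_arrival lambda V h `&` environment_jump Z h) w.
pose i3 w : R := \1_(some_arrival lambda V h) w.
pose i4 w : R := \1_(environment_jump Z h) w.
pose i5 w : R := \1_(low h) w.
pose G w := M * (i1 w + i2 w + h * (i3 w + i4 w + i5 w + h)).
have i0 (A : set T) w : 0 <= (\1_A w : R) by rewrite indicE; case: (_ \in _).
have G0 w : 0 <= G w.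
  by rewrite /G mulr_ge0// !addr_ge0 ?i0// mulr_ge0// !addr_ge0 ?i0.
have bi1 : bounded_measurable i1 by exact: bounded_measurable_indic.
have bi2 : bounded_measurable i2.
  by apply: bounded_measurable_indic; exact: measurableI.
have bi3 : bounded_measurable i3 by exact: bounded_measurable_indic.
have bi4 : bounded_measurable i4 by exact: bounded_measurable_indic.
have bi5 : bounded_measurable i5 by exact: bounded_measurable_indic.
have bh (x : R) : bounded_measurable (fun _ : T => x) by exact: bounded_measurable_cst.
have bi34 := bounded_measurableD bi3 bi4.
have bi345 := bounded_measurableD bi34 bi5.
have bi345h := bounded_measurableD bi345 (bh h).
have bhi := bounded_measurableM (bh h) bi345h.
have bi12 := bounded_measurableD bi1 bi2.
have bin := bounded_measurableD bi12 bhi.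
have bG : bounded_measurable G by exact: bounded_measurableM.
rewrite -E; apply: le_trans (le_norm_Rintegral_outside _ bG G0 mN PN _) _.
- exact: bounded_measurableB (bounded_measurableD b1 b2) b3.
- by move=> w /pos Vw; exact: (one_step_error Hc Hphi Hr HW theta0 j Vw h01).
rewrite /G bounded_RintegralZ// bounded_RintegralD// bounded_RintegralD//.
rewrite bounded_RintegralZ// bounded_RintegralD// bounded_RintegralD//.
rewrite bounded_RintegralD// /i1 /i2 /i3 /i4 /i5 !Rintegral_indic//; last first.
  exact: measurableI.
rewrite Rintegral_cst//; have /= -> := probability_setT P; rewrite mulr1.
rewrite /one_step_rate [leRHS]mulrCA ler_wpM2l//.
have H1 := prob_some_arrival h0; have H2 := prob_two_arrivals h0.
have H3 := prob_arrival_jump h0.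
have : h * fine (P (some_arrival lambda V h)) <= h * (l1 * h) by rewrite ler_wpM2l.
move: H2 H3; rewrite expr2; lra.
Qed.

(** The events decrease to the empty set because [low] leaves out the value 0, where the workload
    may have an atom. *)
Let cvg_low : fine (P (low n.+1%:R^-1)) @[n --> \oo] --> (0 : R).
Proof.
have cb0 : 0 <= cbar by exact: sumr_ge0.
have cap0 : \bigcap_n low n.+1%:R^-1 = set0.
  apply/seteqP; split=> w // lw.
  have /andP[W0 _] := lw 0%N I.
  have cb : cbar * n.+1%:R^-1 @[n --> \oo] --> (0 : R).
    by rewrite -[X in _ --> X](mulr0 cbar); apply: cvgMr; exact: (@cvg_harmonic R).
  have [n _ /(_ n (leqnn n)) /= nW] := cvgr_lt 0 cb _ W0.
  have /andP[_ Wl] := lw n I.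
  by have := le_lt_trans Wl nW; rewrite ltxx.
have : (P \o (fun n => low n.+1%:R^-1)) n @[n --> \oo]
    --> P (\bigcap_n low n.+1%:R^-1).
  apply: nonincreasing_cvg_mu.
  - by rewrite ltey_eq fin_num_measure.
  - by [].
  - by rewrite cap0.
  - move=> n m nm; apply/subsetPset => w /andP[w0 wm]; rewrite /low/= w0/=.
    by apply: le_trans wm _; rewrite ler_wpM2l// lef_pV2 ?posrE// ler_nat.
by rewrite cap0 measure0 => /fine_cvgP[].
Qed.

Lemma transform_equation j : \sum_i psi i * Q i j
  = lambda j * (1 - beta j) * psi j - theta * c j * (psi j - idle_probability j).
Proof.
have [p psg markov] := environment_markov HZ.
set C := RHS; pose h n : R := n.+1%:R^-1.
have h01 n : 0 < h n <= 1.
  by rewrite /h invr_gt0 ltr0n/= invf_le1 ?ltr0n// ler1n.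
have hcvg : h n @[n --> \oo] --> (0 : R) by exact: (@cvg_harmonic R).
pose u n := \sum_i psi i * ((p (h n) i j - (1%:M : 'M[R]_D) i j) / h n).
have ucvg : u n @[n --> \oo] --> \sum_i psi i * Q i j.
  apply: cvgr_sum => i; apply: cvgMr.
  have /cvg_at_rightP := @semigroup_generator _ _ _ _ psg i j; apply; split=> // n.
  by case/andP: (h01 n).
(* The price of replacing [1 - expR (- lambda j * h n)] by [lambda j * h n], divided by [h n]. *)
pose K := lambda j ^+ 2 * `|psi j * (1 - beta j)|.
pose rate n := one_step_rate (h n) + K * h n.
have rcvg : rate n @[n --> \oo] --> (0 : R).
  have -> : (0 : R) = M * (0 * (l2 + l1 + 1) + (l1 + 1) * 0 + 0) + K * 0.
    by rewrite !(mulr0,mul0r,addr0).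
  apply: cvgD; last exact: cvgMr.
  apply: cvgMr; apply: cvgD; last exact: cvg_low.
  by apply: cvgD; [exact: cvgMl|apply: cvgMr; exact: (cvg_environment_jump HZ)].
have ur n : `|C - u n| <= rate n.
  have /andP[h0 h1] := h01 n.
  rewrite -(ler_pM2l h0) -[X in X * `|_|](gtr0_norm h0) -normrM.
  have p0 i k : 0 <= p (h n) i k by apply: (semigroup_ge0 psg); exact: ltW.
  have step := transform_step j (h01 n) markov p0.
  have hu : h n * u n = \sum_i psi i * p (h n) i j - psi j.
    rewrite mulr_sumr.
    have -> : psi j = \sum_i psi i * (1%:M : 'M[R]_D) i j.
      rewrite (bigD1 j)//= big1 ?addr0 => [|i ij]; rewrite mxE ?eqxx ?mulr1//.
      by rewrite (negbTE ij) mulr0.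
    rewrite -sumrB; apply: eq_bigr => i _; field.
    by rewrite gt_eqF.
  have lh0 : 0 <= lambda j * h n by rewrite mulr_ge0// ltW.
  have /andP[y0 y1] := expRN_taylor1 lh0.
  have -> : h n * (C - u n) = (psi j - \sum_i psi i * p (h n) i j
    + (1 - expR (- lambda j * h n)) * psi j * (1 - beta j)
    - theta * h n * c j * (psi j - idle_probability j))
    + (expR (- (lambda j * h n)) - 1 + lambda j * h n) * (psi j * (1 - beta j)).
    rewrite mulrBr hu /C mulNr; ring.
  apply: le_trans (ler_normD _ _) _.
  rewrite /rate [leRHS]mulrDr; apply: lerD; first exact: step.
  rewrite normrM (ger0_norm y0).
  have -> : h n * (K * h n) = (lambda j * h n) ^+ 2 * `|psi j * (1 - beta j)|.
    by rewrite /K; ring.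
  by rewrite ler_wpM2r.
apply: (cvg_unique _ ucvg) => //.
have lo : C - rate n @[n --> \oo] --> C.
  by rewrite -[X in _ --> X]subr0; apply: cvgB => //; exact: cvg_cst.
have hi : C + rate n @[n --> \oo] --> C.
  by rewrite -[X in _ --> X]addr0; apply: cvgD => //; exact: cvg_cst.
apply: (squeeze_cvgr _ lo hi); apply: nearW => n.
by have := ur n; rewrite ler_norml => /andP[? ?]; apply/andP; split; lra.
Qed.

End fixed_theta.
End transform_equation.

(** * Small values of the transform variable *)

Section small_parameter.
Variable R : realType.

(** For [y >= 0] a bounded approximation of [y] from below, whose mean can be read off the
    transform. *)
Definition exp_quotient (theta y : R) : R := (1 - expR (- (theta * y))) / theta.

Lemma exp_quotient_bounds theta y : 0 < theta -> 0 <= y ->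
  0 <= exp_quotient theta y <= y.
Proof.
move=> t0 y0; have /andP[H1 H2] := expRN_bounds (mulr_ge0 (ltW t0) y0).
rewrite /exp_quotient divr_ge0 ?(ltW t0)//=.
by rewrite ler_pdivrMr// [y * _]mulrC.
Qed.

Lemma exp_quotient_remainder theta y : 0 < theta -> 0 <= y ->
  0 <= (y - exp_quotient theta y) / theta <= y ^+ 2.
Proof.
move=> t0 y0; have /andP[H1 H2] := expRN_taylor1 (mulr_ge0 (ltW t0) y0).
have -> : (y - exp_quotient theta y) / theta
    = (expR (- (theta * y)) - 1 + theta * y) / theta ^+ 2.
  by rewrite /exp_quotient; field; rewrite gt_eqF.
have t2 : 0 < theta ^+ 2 by exact: exprn_gt0.
rewrite divr_ge0 ?(ltW t2)//= ler_pdivrMr//.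
by rewrite -exprMn [y * _]mulrC.
Qed.

Lemma exp_quotient_remainder2 theta y : 0 < theta -> 0 <= y ->
  `|(y - exp_quotient theta y) / theta - y ^+ 2 / 2| <= theta * y ^+ 3.
Proof.
move=> t0 y0; have H := expRN_taylor2 (mulr_ge0 (ltW t0) y0).
have -> : (y - exp_quotient theta y) / theta - y ^+ 2 / 2
    = (expR (- (theta * y)) - 1 + theta * y - (theta * y) ^+ 2 / 2) / theta ^+ 2.
  by rewrite /exp_quotient; field; rewrite gt_eqF.
rewrite normrM [X in _ * X]ger0_norm ?invr_ge0 ?sqr_ge0//.
rewrite ler_pdivrMr ?exprn_gt0//; apply: le_trans H _.
by rewrite le_eqVlt; apply/orP; left; apply/eqP; ring.
Qed.

(** A sequence of values of theta, since dominated convergence and Fatou's lemma are applied along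
    sequences. *)
Definition mesh (n : nat) : R := n.+1%:R^-1.

Lemma mesh_gt0 n : 0 < mesh n.
Proof. by rewrite /mesh invr_gt0 ltr0n. Qed.

Lemma cvg_mesh : mesh n @[n --> \oo] --> (0 : R).
Proof. exact: (@cvg_harmonic R). Qed.

Lemma cvgr_squeeze_dist (u v : nat -> R) (l : R) : v n @[n --> \oo] --> (0 : R) ->
  (forall n, `|u n - l| <= v n) -> u n @[n --> \oo] --> l.
Proof.
move=> v0 uv.
have lo : l - v n @[n --> \oo] --> l.
  by rewrite -[X in _ --> X]subr0; apply: cvgB => //; exact: cvg_cst.
have hi : l + v n @[n --> \oo] --> l.
  by rewrite -[X in _ --> X]addr0; apply: cvgD => //; exact: cvg_cst.
apply: (squeeze_cvgr _ lo hi); apply: nearW => n.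
by have := uv n; rewrite ler_norml => /andP[? ?]; apply/andP; split; lra.
Qed.

Lemma cvg_mesh_mul (x : R) : mesh n * x @[n --> \oo] --> (0 : R).
Proof. by rewrite -[X in _ --> X](mul0r x); apply: cvgMl; exact: cvg_mesh. Qed.

Lemma cvg_exp_quotient y : 0 <= y -> exp_quotient (mesh n) y @[n --> \oo] --> y.
Proof.
move=> y0; apply: (cvgr_squeeze_dist (cvg_mesh_mul (y ^+ 2))) => n.
have /andP[H1] := exp_quotient_remainder (mesh_gt0 n) y0.
rewrite ler_pdivrMr ?mesh_gt0// => H2.
have /andP[_ H3] := exp_quotient_bounds (mesh_gt0 n) y0.
by rewrite distrC ger0_norm ?subr_ge0// mulrC.
Qed.

Lemma cvg_exp_quotient_remainder y : 0 <= y ->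
  (y - exp_quotient (mesh n) y) / mesh n @[n --> \oo] --> y ^+ 2 / 2.
Proof.
move=> y0; apply: (cvgr_squeeze_dist (cvg_mesh_mul (y ^+ 3))) => n.
exact: exp_quotient_remainder2 (mesh_gt0 n) y0.
Qed.

End small_parameter.

Lemma dominated_cvg_Rintegral d (T : measurableType d) (R : realType)
    (P : probability T R) (A : set T) (u : nat -> T -> R) (f g : T -> R) :
  measurable A -> (forall n, measurable_fun setT (u n)) ->
  measurable_fun setT f -> P.-integrable A (EFin \o g) ->
  (forall x, u n x @[n --> \oo] --> f x) ->
  (forall n x, `|u n x| <= g x) ->
  \int[P]_(x in A) u n x @[n --> \oo] --> \int[P]_(x in A) f x.
Proof.
move=> mA mu mf ig uf ug.
have [] := @dominated_convergence _ _ _ P A mA (fun n x => (u n x)%:E)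
  (EFin \o f) (EFin \o g).
- by move=> n; apply/measurable_EFinP; exact: measurable_funTS.
- by apply/measurable_EFinP; exact: measurable_funTS.
- by apply/aeW => x _; apply: cvg_EFin; [exact: nearW|exact: uf].
- exact: ig.
- by apply/aeW => x n _; rewrite lee_fin.
move=> if_ _ cvgi; rewrite /Rintegral.
apply: fine_cvg; rewrite fineK//.
exact: integrable_fin_num.
Qed.

(** * Moments of a requirement law from its transform near 0 *)

Section moments.
Variables (R : realType) (mu : probability (measurableTypeR R) R) (h1 h2 : R).
Hypothesis mu_ge0 : mu [set x : R | x < 0] = 0%E.
Hypothesis mean : (\int[mu]_x x%:E)%E = h1%:E.
Hypothesis second : (\int[mu]_x (x ^+ 2)%:E)%E = h2%:E.

Let mid : measurable_fun setT (fun x : measurableTypeR R => x : R).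
Proof. exact: measurable_id. Qed.

Let mabs : measurable_fun setT (fun x : measurableTypeR R => `|x : R|).
Proof. by apply: measurableT_comp; [exact: normr_measurable|exact: mid]. Qed.

Let msqr : measurable_fun setT (fun x : measurableTypeR R => (x : R) ^+ 2).
Proof. by apply: measurable_funX; exact: mid. Qed.

Lemma mean_abs : (\int[mu]_x `|x : R|%:E)%E = h1%:E.
Proof.
rewrite -mean; apply: ae_eq_integral => //.
- exact/measurable_EFinP.
- exists [set x : R | x < 0]; split=> //.
    have -> : [set x : R | x < 0] = `]-oo, 0[%classic.
      by apply/seteqP; split=> x /=; rewrite in_itv.
    exact: measurable_itv.
  move=> x /= /not_implyP[_ h]; rewrite ltNge; apply/negP => x0; apply: h.
  by rewrite ger0_norm.
Qed.

Lemma integrable_abs : mu.-integrable setT (fun x => `|x : R|%:E).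
Proof.
apply/integrableP; split; first exact/measurable_EFinP.
under eq_integral do rewrite gee0_abs ?lee_fin//.
by rewrite mean_abs ltry.
Qed.

Lemma integrable_sqr : mu.-integrable setT (fun x => ((x : R) ^+ 2)%:E).
Proof.
apply/integrableP; split; first exact/measurable_EFinP.
under eq_integral do rewrite gee0_abs ?lee_fin ?sqr_ge0//.
by rewrite second ltry.
Qed.

Let beta theta := \int[mu]_x expR (- (theta * `|x : R|)).
Let k1 theta (x : R) := exp_quotient theta `|x|.
Let k2 theta (x : R) := (`|x| - exp_quotient theta `|x|) / theta.

Let bounded_exp theta : 0 < theta ->
  bounded_measurable (fun x : measurableTypeR R => expR (- (theta * `|x : R|))).
Proof.
move=> t0; apply: bounded_measurable_expRN => [|x].
  by apply: measurable_funM; [exact: measurable_cst|exact: mabs].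
by rewrite mulr_ge0// ltW.
Qed.

Let bounded_k1 theta : 0 < theta ->
  bounded_measurable (k1 theta : measurableTypeR R -> R).
Proof.
move=> t0; apply: bounded_measurableM; last exact: bounded_measurable_cst.
by apply: bounded_measurableB; [exact: bounded_measurable_cst|exact: bounded_exp].
Qed.

Let measurable_k2 theta : 0 < theta ->
  measurable_fun setT (k2 theta : measurableTypeR R -> R).
Proof.
move=> t0; apply: measurable_funM; last exact: measurable_cst.
by apply: measurable_funB; [exact: mabs|case: (bounded_k1 t0)].
Qed.

Lemma integral_exp_quotient theta : 0 < theta ->
  \int[mu]_x k1 theta x = (1 - beta theta) / theta.
Proof.
move=> t0; rewrite /k1 /exp_quotient RintegralZr//; last first.
  apply: bounded_measurable_integrable => //.
  by apply: bounded_measurableB; [exact: bounded_measurable_cst|exact: bounded_exp].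
rewrite bounded_RintegralB; [|exact: bounded_measurable_cst|exact: bounded_exp].
by rewrite Rintegral_cst//; have /= -> := probability_setT mu; rewrite mulr1.
Qed.

Lemma integral_exp_quotient_remainder theta : 0 < theta ->
  \int[mu]_x k2 theta x = (h1 - (1 - beta theta) / theta) / theta.
Proof.
move=> t0; have ik1 : mu.-integrable setT (EFin \o k1 theta).
  by apply: bounded_measurable_integrable => //; exact: bounded_k1.
rewrite /k2 RintegralZr//; last first.
  have := integrableB measurableT integrable_abs ik1.
  by apply: eq_integrable => // x _ /=; rewrite EFinB.
rewrite RintegralB//; last exact: integrable_abs.
rewrite -/(k1 theta) integral_exp_quotient//; congr ((_ - _) / _).
by rewrite /Rintegral mean_abs.
Qed.

Lemma cvg_mean :
  (1 - beta (mesh R n)) / mesh R n @[n --> \oo] --> h1.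
Proof.
have -> : h1 = \int[mu]_x `|x : R| by rewrite /Rintegral mean_abs.
under eq_fun do rewrite -(integral_exp_quotient (mesh_gt0 _ _)).
apply: (@dominated_cvg_Rintegral _ _ _ mu setT (fun n x => k1 (mesh R n) x)
  (fun x => `|x : R|) (fun x => `|x : R|)) => //.
- by move=> n; case: (bounded_k1 (mesh_gt0 R n)).
- exact: integrable_abs.
- by move=> x; exact: cvg_exp_quotient.
- move=> n x; have /andP[H1 H2] := exp_quotient_bounds (mesh_gt0 R n) (normr_ge0 x).
  by rewrite ger0_norm.
Qed.

(** The cubic bound of [exp_quotient_remainder2] is used only for the pointwise limit; domination is
    by the square, so a finite second moment is enough. *)
Lemma cvg_second :
  (h1 - (1 - beta (mesh R n)) / mesh R n) / mesh R n @[n --> \oo] --> h2 / 2.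
Proof.
have -> : h2 / 2 = \int[mu]_x ((x : R) ^+ 2 / 2).
  by rewrite RintegralZr ?integrable_sqr// /Rintegral second.
under eq_fun do rewrite -(integral_exp_quotient_remainder (mesh_gt0 _ _)).
apply: (@dominated_cvg_Rintegral _ _ _ mu setT (fun n x => k2 (mesh R n) x)
  (fun x => (x : R) ^+ 2 / 2) (fun x => (x : R) ^+ 2)) => //.
- by move=> n; exact: measurable_k2 (mesh_gt0 R n).
- by apply: measurable_funM; [exact: msqr|exact: measurable_cst].
- exact: integrable_sqr.
- move=> x; rewrite -(real_normK (num_real x)).
  exact: cvg_exp_quotient_remainder.
- move=> n x.
  have /andP[H1 H2] := exp_quotient_remainder (mesh_gt0 R n) (normr_ge0 x).
  by rewrite ger0_norm// (le_trans H2)// real_normK ?num_real.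
Qed.

Lemma mean_ge0 : 0 <= h1.
Proof. by rewrite -lee_fin -mean_abs; apply: integral_ge0 => x _; rewrite lee_fin. Qed.

Lemma second_ge0 : 0 <= h2.
Proof. by rewrite -lee_fin -second; apply: integral_ge0 => x _; rewrite lee_fin sqr_ge0. Qed.

(** For each [e > 0] one has |x| <= e + x^2 / e, because (|x| - e)^2 + e |x| is nonnegative; with a
    vanishing second moment the mean is at most [e]. *)
Lemma second_eq0 : h2 = 0 -> h1 = 0.
Proof.
move=> h20; apply/eqP; rewrite eq_le mean_ge0 andbT.
apply/ler_addgt0Pr => e e0; rewrite add0r.
have ie : mu.-integrable setT (fun x => (e + (x : R) ^+ 2 / e)%:E).
  have ic : mu.-integrable setT (fun=> e%:E) by exact: finite_measure_integrable_cst.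
  have is_ := integrableZr measurableT e^-1 integrable_sqr.
  have := integrableD measurableT ic is_.
  by apply: eq_integrable => // x _ /=; rewrite EFinD EFinM.
have -> : h1 = \int[mu]_x `|x : R| by rewrite /Rintegral mean_abs.
have <- : \int[mu]_x (e + (x : R) ^+ 2 / e) = e.
  rewrite RintegralD//; last 2 first.
  - exact: finite_measure_integrable_cst.
  - have := integrableZr measurableT e^-1 integrable_sqr.
    by apply: eq_integrable => // x _ /=; rewrite EFinM.
  rewrite RintegralZr ?integrable_sqr// Rintegral_cst//.
  have /= -> := probability_setT mu.
  by rewrite /Rintegral second h20 mul0r mulr1 addr0.
apply: le_Rintegral => //; first exact: integrable_abs.
move=> x _; rewrite -lerBlDl ler_pdivlMr//.
rewrite -(real_normK (num_real x)); have := sqr_ge0 (`|x| - e).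
by have := mulr_ge0 (normr_ge0 x) (ltW e0); nra.
Qed.

End moments.

Section nonnegative_mean.
Context d (T : measurableType d) (R : realType) (P : probability T R).
Variables (X : {RV P >-> R}) (X0 : forall w, 0 <= X w).

Lemma bounded_exp_quotient theta : 0 < theta ->
  bounded_measurable (fun w => exp_quotient theta (X w)).
Proof.
move=> t0; apply: bounded_measurableM; last exact: bounded_measurable_cst.
apply: bounded_measurableB; first exact: bounded_measurable_cst.
apply: bounded_measurable_expRN => [|w]; last by rewrite mulr_ge0// ltW.
by apply: measurable_funM; [exact: measurable_cst|exact: measurable_funPT].
Qed.

(** Fatou's lemma bounds the mean of [X] by [l]; the converse holds because every [exp_quotient]
    lies below [X]. *)
Lemma mean_of_exp_quotient (l : R) :
  \int[P]_w exp_quotient (mesh R n) (X w) @[n --> \oo] --> l ->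
  (\int[P]_w (X w)%:E)%E = l%:E.
Proof.
move=> yl; pose F n w := (exp_quotient (mesh R n) (X w))%:E.
have F0 n w : (0 <= F n w)%E.
  by rewrite lee_fin; case/andP: (exp_quotient_bounds (mesh_gt0 R n) (X0 w)).
have mF n : measurable_fun setT (F n).
  by apply/measurable_EFinP; case: (bounded_exp_quotient (mesh_gt0 R n)).
have intF n : (\int[P]_w F n w)%E = (\int[P]_w exp_quotient (mesh R n) (X w))%:E.
  rewrite /Rintegral fineK//; apply: integrable_fin_num => //.
  by apply: bounded_measurable_integrable => //; exact: (bounded_exp_quotient (mesh_gt0 R n)).
have cvgF : (\int[P]_w F n w)%E @[n --> \oo] --> l%:E.
  by under eq_fun do rewrite intF; apply: cvg_EFin; [exact: nearW|exact: yl].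
apply/eqP; rewrite eq_le; apply/andP; split.
  have -> : (\int[P]_w (X w)%:E)%E = (\int[P]_w limn_einf (F ^~ w))%E.
    apply: eq_integral => w _.
    have cw : F ^~ w @ \oo --> (X w)%:E.
      by apply: cvg_EFin; [exact: nearW|exact: cvg_exp_quotient].
    by rewrite is_cvg_limn_einfE; [apply/esym/cvg_lim|apply/cvg_ex; exists (X w)%:E].
  have : (limn_einf (fun n => \int[P]_w F n w) = l%:E)%E.
    by rewrite is_cvg_limn_einfE; [exact/cvg_lim|apply/cvg_ex; exists l%:E].
  by move=> <-; apply: fatou.
have -> : l%:E = limn (fun n => (\int[P]_w F n w)%E) by apply/esym/cvg_lim.
apply: lime_le; first by apply/cvg_ex; exists l%:E.
apply: nearW => n; apply: ge0_le_integral => //.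
- by apply/measurable_EFinP; exact: measurable_funPT.
- move=> w _; rewrite lee_fin.
  by case/andP: (exp_quotient_bounds (mesh_gt0 R n) (X0 w)).
Qed.

End nonnegative_mean.

(** * Stationary law of workload and environment *)

Section stationary_queue.
Context d (T : measurableType d).
Variables (R : realType) (D : nat) (P : probability T R).
Variables (Z : R -> T -> 'I_D) (W : R -> {RV P >-> R}).
Hypothesis mZ : forall t i, 0 <= t -> measurable [set w | Z t w = i].
Hypothesis W0 : forall t w, 0 <= t -> 0 <= W t w.
Hypothesis Hst : steady_state Z W.

Let zero0 : (0 : R) <= 0 := lexx 0.

Lemma state_partition t A : 0 <= t -> measurable A ->
  P A = (\sum_i P (A `&` [set w | Z t w = i]))%E.
Proof.
move=> t0 mA.
rewrite -(@measure_bigsetU_ord _ _ _ P D xpredT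
  (fun i => A `&` [set w | Z t w = i])).
- congr (P _); apply/seteqP; split=> [w Aw|].
    by rewrite (bigD1 (Z t w))//=; left.
  by elim/big_ind: _ => // X Y XA YA w [/XA|/YA].
- by move=> i; apply: measurableI => //; exact: mZ.
- apply/trivIsetP => i j _ _ /eqP ij; apply/seteqP; split=> // w.
  by move=> [[_ Zi] [_ Zj]]; apply: ij; rewrite -Zi -Zj.
Qed.

Lemma stationary_mean t : 0 <= t ->
  (\int[P]_w (W t w)%:E = \int[P]_w (W 0%R w)%:E)%E.
Proof.
move=> t0.
(* [integral_eq_scale] takes a function that is nonnegative on the whole line, hence the absolute
   value. *)
transitivity (\int[P]_w (`|W t w|%R)%:E)%E.
  by apply: eq_integral => w _; rewrite ger0_norm// W0.
transitivity (\int[P]_w (`|W 0%R w|%R)%:E)%E; last first.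
  by apply: eq_integral => w _; rewrite ger0_norm// W0.
rewrite (@integral_eq_scale _ _ _ P (W t) (W 0) setT setT 1 Num.norm)//.
- by rewrite mul1e.
- move=> A mA; rewrite mul1e !setIT.
  rewrite (state_partition t0); last exact: (measurable_funPTI (W t)).
  rewrite [RHS](state_partition zero0); last exact: (measurable_funPTI (W 0)).
  by apply: eq_bigr => i _; exact: Hst.
Qed.

Let bounded_e theta : 0 < theta ->
  bounded_measurable (fun w => expR (- (theta * W 0 w))).
Proof.
move=> th0; apply: bounded_measurable_expRN => [|w].
  by apply: measurable_funM; [exact: measurable_cst|exact: measurable_funPT].
by rewrite mulr_ge0 ?W0// ltW.
Qed.

Lemma cvg_workload_transform j :
  workload_transform Z W (mesh R n) j @[n --> \oo]
    --> fine (P [set w | Z 0 w = j]).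
Proof.
have -> : fine (P [set w | Z 0 w = j]) = \int[P]_(w in [set w | Z 0 w = j]) 1.
  by rewrite Rintegral_cst ?mul1r//; exact: mZ.
apply: (@dominated_cvg_Rintegral _ _ _ P _
  (fun n w => expR (- (mesh R n * W 0 w))) (fun=> 1) (fun=> 1)).
- exact: mZ.
- by move=> n; case: (bounded_e (mesh_gt0 R n)).
- exact: measurable_cst.
- by apply: bounded_measurable_integrable; [exact: mZ|exact: bounded_measurable_cst].
- move=> w; apply: (cvgr_squeeze_dist (cvg_mesh_mul (W 0 w))) => n.
  have sW : 0 <= mesh R n * W 0 w by rewrite mulr_ge0 ?W0// ltW// mesh_gt0.
  by have /andP[H1 H2] := expRN_bounds sW; rewrite distrC ger0_norm.
- move=> n w; have sW : 0 <= mesh R n * W 0 w.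
    by rewrite mulr_ge0 ?W0// ltW// mesh_gt0.
  by rewrite ger0_norm ?expR_ge0// -expR0 ler_expR oppr_le0.
Qed.

Lemma integral_exp_quotient_workload theta : 0 < theta ->
  \int[P]_w exp_quotient theta (W 0 w)
    = (1 - \sum_j workload_transform Z W theta j) / theta.
Proof.
move=> th0.
have be := bounded_e th0.
have bi j : bounded_measurable (fun w =>
    \1_[set w | Z 0 w = j] w * expR (- (theta * W 0 w))).
  by apply: bounded_measurableM => //; apply: bounded_measurable_indic; exact: mZ.
have -> : \sum_j workload_transform Z W theta j
    = \int[P]_w expR (- (theta * W 0 w)).
  transitivity (\int[P]_w (\sum_j \1_[set w | Z 0 w = j] w * expR (- (theta * W 0 w)))).
    rewrite (bounded_Rintegral_sum P _ bi).2; apply: eq_bigr => j _.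
    by rewrite Rintegral_indic_mul.
  apply: eq_Rintegral => w _; rewrite (bigD1 (Z 0 w))//= big1 ?addr0.
    by rewrite indicE mem_set// mul1r.
  by move=> i ni; rewrite indicE memNset ?mul0r//= => Zi; rewrite Zi eqxx in ni.
rewrite /exp_quotient RintegralZr//; last first.
  by apply: bounded_measurable_integrable => //; apply: bounded_measurableB => //;
    exact: bounded_measurable_cst.
rewrite bounded_RintegralB//; last exact: bounded_measurable_cst.
by rewrite Rintegral_cst//; have /= -> := probability_setT P; rewrite mulr1.
Qed.

End stationary_queue.

(** * Limit of the transform equation *)

Theorem proposition3p1 (R : realType) (D : nat)
    (Q : 'M[R]_D) (pi : 'rV[R]_D) (lambda c h1 h2 : 'I_D -> R)
    (H : 'I_D -> probability (measurableTypeR R) R)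
    (HQ : is_generator Q) (Hirr : irreducible Q)
    (Hpi : invariant_distribution Q pi)
    (Hlambda : forall i, 0 <= lambda i)
    (Hc : forall i, 0 <= c i) (Hcinf : 0 < mean_capacity pi c)
    (HH : forall i, H i [set x : R | x < 0] = 0%E)
    (Hh1 : forall i, (\int[H i]_x x%:E)%E = (h1 i)%:E)
    (Hh2 : forall i, (\int[H i]_x (x ^+ 2)%:E)%E = (h2 i)%:E)
    (d : measure_display) (T : measurableType d) (P : probability T R)
    (dS : measure_display) (S : measurableType dS) (X0 : {mfun T >-> S})
    (Z : R -> T -> 'I_D) (HZ : markov_environment P Q X0 Z)
    (V B : 'I_D -> nat -> {RV P >-> R})
    (Hin : modulated_input lambda H X0 Z V B)
    (b : nat -> {mfun S >-> R})
    (phi : discipline R D S) (Hphi : service_discipline phi)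
    (r : R -> T -> customer D -> R)
    (Hr : queue_dynamics lambda c X0 Z V B b phi r)
    (W : R -> {RV P >-> R}) (HW : is_workload r W) (Hst : steady_state Z W)
    (t : R) (Ht : 0 <= t)
    (a : 'cV[R]_D)
    (Ha : forall i, (Q *m a) i 0 =
       c i - lambda i * h1 i
       - mean_capacity pi c * (1 - traffic_intensity pi lambda h1 c)) :
  let p0 i : R := fine (P [set w | W t w = 0 /\ Z t w = i]) in
  ('E_P[W t] =
    ((\sum_i (pi 0 i * lambda i * h2 i / 2
              + a i 0 * pi 0 i * (lambda i * h1 i - c i)
              + p0 i * c i * a i 0))
     / (mean_capacity pi c * (1 - traffic_intensity pi lambda h1 c)))%:E)%E /\
  1 - traffic_intensity pi lambda h1 c =
    (\sum_i p0 i * c i) / mean_capacity pi c.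
Proof.
move=> p0.
have mZ s i : 0 <= s -> measurable [set w | Z s w = i].
  exact: (measurable_state HZ).
have W0 s w : 0 <= s -> 0 <= W s w by exact: (workload_ge0 Hr HW).
have [Qoff Qsum] := HQ; have [pi0 pi1 piQ] := Hpi.
set m := mean_capacity pi c * _ in Ha *.
pose q := idle_probability Z W.
have p0E i : p0 i = q i.
  by congr fine; exact: (Hst t i [set 0] Ht (measurable_set1 0)).
pose psi n := workload_transform Z W (mesh R n).
pose a1 n j := (1 - requirement_transform H (mesh R n) j) / mesh R n.
pose a2 n j := (h1 j - a1 n j) / mesh R n.
pose g n j := lambda j * a1 n j * psi n j - c j * (psi n j - q j).
have a1cvg j : a1 n j @[n --> \oo] --> h1 j by exact: cvg_mean.
have a2cvg j : a2 n j @[n --> \oo] --> h2 j / 2 by exact: cvg_second.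
(* The factor theta is taken out of the right-hand side: [g] converges, so in the limit the
   left-hand side vanishes. *)
have teq n j : \sum_i psi n i * Q i j = mesh R n * g n j.
  have sn := mesh_gt0 R n.
  rewrite (transform_equation Hlambda Hc HZ Hin Hphi Hr HW Hst sn).
  by rewrite /g /a1 -/(q j) -/(psi n j); field; rewrite gt_eqF.
pose mu : 'rV[R]_D := \row_j fine (P [set w | Z 0 w = j]).
have psicvg j : psi n j @[n --> \oo] --> mu 0 j.
  by rewrite mxE; exact: cvg_workload_transform.
have gcvg' j : g n j @[n --> \oo]
    --> lambda j * h1 j * mu 0 j - c j * (mu 0 j - q j).
  apply: cvgB; first by apply: cvgM => //; exact: cvgMr.
  by apply: cvgMr; apply: cvgB => //; exact: cvg_cst.
have muE : mu = pi.
  apply: (invariant_distribution_unique HQ Hirr _ _ Hpi).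
    apply/rowP => j; rewrite !mxE.
    have L1 : \sum_i psi n i * Q i j @[n --> \oo] --> \sum_i mu 0 i * Q i j.
      by apply: cvgr_sum => i; exact: cvgMl.
    have L2 : \sum_i psi n i * Q i j @[n --> \oo] --> (0 : R).
      have -> : (fun n => \sum_i psi n i * Q i j) = (fun n => mesh R n * g n j).
        by apply/funext => n; exact: teq.
      rewrite -[X in _ --> X](mul0r (lambda j * h1 j * mu 0 j - c j * (mu 0 j - q j))).
      by apply: cvgM => //; exact: cvg_mesh.
    by apply: (cvg_unique _ L1).
  have := probability_setT P; rewrite (state_partition P mZ (lexx 0))//.
  have Pmu i : P [set w | Z 0 w = i] = (mu 0 i)%:E.
    by rewrite mxE fineK// fin_num_measure//; exact: mZ.
  by under eq_bigr do rewrite setTI Pmu; rewrite sumEFin => -[].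
move: psicvg gcvg'; rewrite muE => psicvg gcvg.
have gsum n : \sum_j g n j = 0.
  have sn : mesh R n != 0 by rewrite gt_eqF// mesh_gt0.
  apply: (mulfI sn); rewrite mulr0 mulr_sumr.
  under eq_bigr do rewrite -teq.
  rewrite exchange_big big1//= => i _.
  by rewrite -mulr_sumr Qsum mulr0.
have meanE : m = mean_capacity pi c - \sum_i pi 0 i * lambda i * h1 i.
  rewrite /m /traffic_intensity mulrBr mulr1; congr (_ - _).
  by rewrite mulrCA mulfV ?mulr1// gt_eqF.
have mE : m = \sum_i c i * q i.
  have : \sum_j g n j @[n --> \oo]
      --> \sum_j (lambda j * h1 j * pi 0 j - c j * (pi 0 j - q j)).
    exact: cvgr_sum.
  have -> : (fun n => \sum_j g n j) = (fun=> 0) by apply/funext => n; exact: gsum.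
  have c0 : (fun=> 0 : R) @ \oo --> (0 : R) by exact: cvg_cst.
  move=> L; have {L} E : 0 = \sum_j (lambda j * h1 j * pi 0 j - c j * (pi 0 j - q j)).
    by apply: (cvg_unique _ c0 L).
  apply/esym/subr0_eq; rewrite meanE [RHS]E /mean_capacity -!sumrB.
  by apply: eq_bigr => i _; ring.
have c_inf : mean_capacity pi c != 0 by rewrite gt_eqF.
have second_claim : 1 - traffic_intensity pi lambda h1 c
    = (\sum_i p0 i * c i) / mean_capacity pi c.
  apply: (mulfI c_inf); rewrite -/m mE mulrCA mulfV// mulr1.
  by apply: eq_bigr => i _; rewrite p0E mulrC.
split=> //.
pose K := \sum_i (pi 0 i * lambda i * h2 i / 2
  + a i 0 * (lambda i * h1 i * pi 0 i - c i * (pi 0 i - q i))).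
have KE : \sum_i (pi 0 i * lambda i * h2 i / 2
              + a i 0 * pi 0 i * (lambda i * h1 i - c i)
              + p0 i * c i * a i 0) = K.
  by apply: eq_bigr => i _; rewrite p0E; ring.
rewrite KE.
pose y n := (1 - \sum_j psi n j) / mesh R n.
(* The sum of the equations ([gsum]) is combined with their pairing with [a] ([E1]), in which [Ha]
   replaces [Q *m a] by [c - lambda h1 - m]. The terms in [c] cancel, those in [lambda] leave
   [h1 j - a1 n j], which is of order theta, and a common factor theta can be divided out. *)
have my n : m * y n = \sum_j (psi n j * lambda j * a2 n j + a j 0 * g n j).
  have sn : mesh R n != 0 by rewrite gt_eqF// mesh_gt0.
  apply: (mulfI sn).
  have E1 : \sum_i psi n i * (c i - lambda i * h1 i - m)
      = mesh R n * \sum_j a j 0 * g n j.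
    transitivity (\sum_i psi n i * (Q *m a) i 0).
      by apply: eq_bigr => i _; rewrite Ha.
    transitivity (\sum_j (\sum_i psi n i * Q i j) * a j 0).
      under [RHS]eq_bigr do rewrite mulr_suml.
      rewrite exchange_big/=; apply: eq_bigr => i _.
      by rewrite mxE mulr_sumr; apply: eq_bigr => j _; rewrite mulrA.
    by rewrite mulr_sumr; apply: eq_bigr => j _; rewrite teq; ring.
  have -> : mesh R n * (m * y n) = m * (1 - \sum_j psi n j).
    by rewrite /y; field.
  rewrite big_split/= [RHS]mulrDr -E1.
  apply: subr0_eq; rewrite -[RHS](gsum n) [m * _]mulrBr mulr1 {1}mE !mulr_sumr.
  rewrite -big_split/= -!sumrB; apply: eq_bigr => i _; rewrite /a2 /g.
  by field.
have Kcvg : m * y n @[n --> \oo] --> K.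
  have -> : (fun n => m * y n) = (fun n =>
      \sum_j (psi n j * lambda j * a2 n j + a j 0 * g n j)) by exact/funext.
  apply: cvgr_sum => j; apply: cvgD; last exact: cvgMr.
  rewrite -mulrA; apply: cvgM => //.
  by apply: cvgMl.
have m_ge0 : 0 <= m.
  by rewrite mE sumr_ge0// => i _; rewrite mulr_ge0// fine_ge0.
have [m0|m_neq0] := eqVneq m 0; last first.
  rewrite unlock (stationary_mean mZ W0 Hst)//.
  apply: mean_of_exp_quotient => [w|]; first exact: W0.
  have -> : (fun n => \int[P]_w exp_quotient (mesh R n) (W 0 w))
      = (fun n => m * y n / m).
    apply/funext => n; rewrite mulrAC divff// mul1r.
    exact: (integral_exp_quotient_workload mZ W0 (mesh_gt0 R n)).
  exact: cvgMl.
exfalso.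
(* The products [m * y n] are identically 0, even if [y n] is unbounded. *)
have K0 : K = 0.
  have c0 : (fun=> 0 : R) @ \oo --> (0 : R) by exact: cvg_cst.
  apply/esym; apply: (cvg_unique _ c0) => //.
  move: Kcvg; have -> // : (fun n => m * y n) = (fun=> 0).
  by apply/funext => n; rewrite m0 mul0r.
(* [m] is a sum of nonnegative terms, so each of them vanishes; this removes the idle probabilities
   from [K]. *)
have cq0 i : c i * q i = 0.
  apply/eqP; move/eqP: mE; rewrite m0 eq_sym psumr_eq0; last first.
    by move=> j _; rewrite mulr_ge0// fine_ge0.
  by move/allP => /(_ i (mem_index_enum _)).
have := dirichlet_form a HQ piQ.
under [X in _ = - 2 * X]eq_bigr do rewrite Ha m0 subr0.
set dir := LHS => dirE.
have dir0 : 0 <= dir.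
  apply: sumr_ge0 => i _; apply: sumr_ge0 => j _.
  have [->|ij] := eqVneq j i; first by rewrite subrr expr0n/= mulr0.
  by rewrite mulr_ge0 ?sqr_ge0// mulr_ge0// Qoff// eq_sym.
(* With [m = 0] the hypothesis on [a] reads [Q *m a = c - lambda h1], so the part of [K] that
   contains [a] is minus the pairing of [a] with [Q *m a] under [pi]. *)
have KE2 : K = (\sum_i pi 0 i * (lambda i * h2 i)) / 2 + dir / 2.
  have -> : dir / 2 = - \sum_i pi 0 i * a i 0 * (c i - lambda i * h1 i).
    by rewrite dirE; field.
  rewrite /K mulr_suml -sumrN -big_split/=; apply: eq_bigr => i _.
  by rewrite [c i * (_ - _)]mulrBr cq0; field.
have pl0 i : 0 <= pi 0 i * (lambda i * h2 i).
  by rewrite !mulr_ge0//; exact: second_ge0 (Hh2 i).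
have : \sum_i pi 0 i * (lambda i * h2 i) = 0.
  apply/eqP; rewrite eq_le; apply/andP; split; last exact: sumr_ge0.
  by move: K0; rewrite KE2; lra.
move/eqP; rewrite psumr_eq0// => /allP pl.
(* If the product vanishes through [h2 i], then [h1 i] vanishes as well; otherwise [pi 0 i] or
   [lambda i] does. *)
have load0 : \sum_i pi 0 i * lambda i * h1 i = 0.
  apply: big1 => i _; have /= := pl i (mem_index_enum _).
  rewrite !mulf_eq0 => /or3P[/eqP->|/eqP->|/eqP h20].
  - by rewrite !mul0r.
  - by rewrite mulr0 mul0r.
  - by rewrite (second_eq0 (HH i) (Hh1 i) (Hh2 i) h20) mulr0.
by move: meanE; rewrite load0 subr0 m0 => E; move: Hcinf; rewrite -E ltxx.
Qed.
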